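(* Let $0<2r<R$ and let $\Omega\subset\mathbb{R}^3$ be the interior of a ring torus with minor radius $r$ and major radius $R$, i.e. the domain generated by rotating about the $x_3$-axis a disc of radius $r$ whose centre lies in the plane $x_3=0$ at distance $R$ from the axis, the disc being co-planar with the axis. Let $\delta(\mathbf{x})=\operatorname{dist}(\mathbf{x},\partial\Omega)$ and let $\mathcal{R}(\Omega)$ be the ridge of $\Omega$. Then $\Delta\delta<0$ in $\Omega\setminus\mathcal{R}(\Omega)$, and for every $p\in(1,\infty)$ and every $f\in C_0^\infty(\Omega)$, $$\int_\Omega|\nabla\delta\cdot\nabla f|^p\,d\mathbf{x}\ \ge\ \left(\frac{p-1}{p}\right)^p\int_\Omega\frac{|f|^p}{\delta^p}\,d\mathbf{x}+\left(\frac{p-1}{p}\right)^{p-1}\int_\Omega\left(\frac{1}{r-\delta}-\frac{1}{\sqrt{x_1^2+x_2^2}}\right)\frac{|f|^p}{\delta^{p-1}}\,d\mathbf{x},$$ where $\mathbf{x}=(x_1,x_2,x_3)$, and the factor $\frac{1}{r-\delta}-\frac{1}{\sqrt{x_1^2+x_2^2}}$ in the last integrand is positive.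
   Context: For this torus the ridge $\mathcal{R}(\Omega)$ is the circle $\{\mathbf{x}: x_1^2+x_2^2=R^2,\ x_3=0\}$ of centres of the cross-sectional discs, and $\delta(\mathbf{x})=r-\operatorname{dist}(\mathbf{x},\mathcal{R}(\Omega))$ for $\mathbf{x}\in\Omega$. *)

(* Defs.v *)
From HB Require Import structures.
From mathcomp Require Import all_boot all_order all_algebra.
From mathcomp Require Import all_classical all_reals all_analysis.
Set Implicit Arguments.
Unset Strict Implicit.
Unset Printing Implicit Defensive.
Import Order.TTheory GRing.Theory Num.Theory.
Import numFieldNormedType.Exports.
Local Open Scope classical_set_scope.
Local Open Scope ring_scope.

(* A point (x1, x2, x3) is ((x1, x2), x3).  The library norm on products is the
   max norm; it gives the topology and the derivatives below, but all distances
   are Euclidean and go through [enorm]. *)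
Definition dot (R : realType) (u v : R * R * R) : R :=
  u.1.1 * v.1.1 + u.1.2 * v.1.2 + u.2 * v.2.

Definition enorm (R : realType) (u : R * R * R) : R := Num.sqrt (dot u u).

Definition lebesgue3 (R : realType) :=
  ((@lebesgue_measure R \x @lebesgue_measure R) \x @lebesgue_measure R)%E.
Arguments lebesgue3 R : clear implicits.

Definition basis3 (R : realType) (i : 'I_3) : R * R * R :=
  ((i == 0 :> nat)%:R, (i == 1 :> nat)%:R, (i == 2 :> nat)%:R).

Definition partial (R : realType) (i : 'I_3) (f : R * R * R -> R) :
    R * R * R -> R :=
  fun x => 'D_(basis3 R i) f x.

Definition grad (R : realType) (f : R * R * R -> R) (x : R * R * R) :
    R * R * R :=
  (partial 0 f x, partial 1 f x, partial 2 f x).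

Definition laplacian (R : realType) (f : R * R * R -> R) (x : R * R * R) : R :=
  \sum_(i < 3) partial i (partial i f) x.

(* ['D_v] is a total operator with a default value, so that a claim about
   [laplacian f x] only has its meaning together with this condition. *)
Definition has_laplacian (R : realType) (f : R * R * R -> R)
    (x : R * R * R) : Prop :=
  forall i : 'I_3, (\forall y \near x, derivable f y (basis3 R i)) /\
                   derivable (partial i f) x (basis3 R i).

Fixpoint Ck (R : realType) (k : nat) (f : R * R * R -> R) : Prop :=
  if k is k'.+1 then
    [/\ continuous f,
        forall (i : 'I_3) (x : R * R * R), derivable f x (basis3 R i)
      & forall i : 'I_3, Ck k' (partial i f)]
  else continuous f.

(* C_0^oo(O); its elements are extended by zero to the whole space. *)
Definition test_function (R : realType) (O : set (R * R * R))
    (f : R * R * R -> R) : Prop :=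
  [/\ forall k, Ck k f,
      compact (closure [set x | f x != 0])
    & closure [set x | f x != 0] `<=` O].

Definition frontier (R : realType) (O : set (R * R * R)) : set (R * R * R) :=
  closure O `\` O°.

Definition bdist (R : realType) (O : set (R * R * R)) (x : R * R * R) : R :=
  inf [set enorm (x - y) | y in frontier O].

Definition near_points (R : realType) (O : set (R * R * R)) (x : R * R * R) :
    set (R * R * R) :=
  [set y | frontier O y /\ enorm (x - y) = bdist O x].

(* For x in O and y a near point of x, follow the ray from y through x as long
   as y remains a near point; the last position is the ridge point of x.  A ray
   on which y remains a near point for ever has no ridge point. *)
Definition ridge (R : realType) (O : set (R * R * R)) : set (R * R * R) :=
  [set c | exists x y : R * R * R,
    let T := [set t : R | 0 < t /\ near_points O (y + t *: (x - y)) y] in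
    [/\ O x, near_points O x y, has_ubound T & c = y + sup T *: (x - y)]].

Definition rotate3 (R : realType) (phi : R) (x : R * R * R) : R * R * R :=
  (cos phi * x.1.1 - sin phi * x.1.2, sin phi * x.1.1 + cos phi * x.1.2, x.2).

Definition meridian_disc (R : realType) (r Rmaj : R) : set (R * R * R) :=
  [set x | x.1.2 = 0 /\ enorm (x - (Rmaj, 0, 0)) < r].

Definition solid_torus (R : realType) (r Rmaj : R) : set (R * R * R) :=
  \bigcup_(phi in [set: R]) rotate3 phi @` meridian_disc r Rmaj.

(* Main.v *)
(* Write d for the distance to the core circle and rho for the distance to the
   axis.  The torus is {d < r}, its boundary is {d = r}, and delta = r - d inside,
   because d is 1-Lipschitz and the normal half-planes through the axis are
   isometric copies of a plane.  Hence - Laplacian delta = (2 - c / rho) / d, which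
   is positive as c < 2 rho, and is at least 1/d - 1/rho.

   For the integral inequality, multiply |f|^p by the vector field
   eta(d) delta^(1-p) grad d, where the cutoff eta is C^1, nondecreasing, and
   vanishes near the core circle.  Its divergence integrates to 0 (Fubini and the
   fundamental theorem of calculus on each coordinate line).  Since eta' >= 0, the
   term with eta' has the favourable sign and can be dropped, and Young's
   inequality on the term with grad f yields the claim with the weight eta.
   Monotone convergence then removes eta.  The core circle is a null set, which
   disposes of the junk values of grad delta and of 1 / (r - delta) there. *)

(* The constants come from optimising Young's inequality. If the field is multiplied by s^(p-1) and
   Young's inequality is applied at scale s, the coefficient left in front of |f|^p / delta^p is
   (p-1) (s^(p-1) - s^p). It is largest at s = (p-1)/p, where it equals s^p, while the curvature
   term keeps the factor s^(p-1).

   The cutoff is forced by grad d, which has no continuous extension to the core circle, so the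
   fundamental theorem fails on lines that meet the circle. The term with eta' has a good sign
   because eta grows in the same direction in which grad d points, away from the core.

   All estimates are made on the torus without its core circle, where every integrand is a
   continuous explicit formula. The return to the full torus relies on comparisons that ask for no
   measurability of the terms carrying default values: monotonicity in the domain for the gradient
   term, and the positive part for the curvature term, whose default value on the circle is
   nonpositive. *)
Require Import Defs.
From HB Require Import structures.
From mathcomp Require Import all_boot all_order all_algebra.
From mathcomp Require Import all_classical all_reals all_analysis.
From mathcomp Require Import measurable_realfun ring lra.
Set Implicit Arguments.
Unset Strict Implicit.
Unset Printing Implicit Defensive.
Import Order.TTheory GRing.Theory Num.Theory.
Import numFieldNormedType.Exports.
Local Open Scope classical_set_scope.
Local Open Scope ring_scope.

(** * Measurability and powers of the absolute value *)

(* The product of three copies of [measurableTypeR], the carrier of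
   [lebesgue3]; it is convertible to [R * R * R] but has another display. *)
Definition mspace3 (R : realType) : measurableType _ :=
  ((measurableTypeR R * measurableTypeR R) * measurableTypeR R)%type.

(** Boxes with rational corners form a countable base of the topology, and each of them is
    measurable in the product sigma-algebra. *)
Lemma open3_measurable (R : realType) (U : set (R * R * R)) :
  open U -> measurable (U : set (mspace3 R)).
Proof.
move=> oU.
pose I (ab : rat * rat) : set R := `]ratr ab.1, ratr ab.2[%classic.
pose box (i : (rat * rat) * (rat * rat) * (rat * rat)) : set (R * R * R) :=
  (I i.1.1 `*` I i.1.2) `*` I i.2.
have box_meas i : measurable (box i : set (mspace3 R)).
  apply: measurableX; last exact: measurable_itv.
  by apply: measurableX; exact: measurable_itv.
have -> : U = \bigcup_i (if pselect (box i `<=` U) then box i else set0).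
  apply/seteqP; split=> [x Ux|x [i _]]; last by case: pselect => // iU /iU.
  have /nbhs_ballP[e /= e0 xeU] : nbhs x U by exact: open_nbhs_nbhs.
  have itv (t : R) : exists ab : rat * rat, I ab t /\ I ab `<=` ball t e.
    have [|a] := @rat_in_itvoo R (t - e) t; first by rewrite ltrBlDr ltrDl.
    have [|b] := @rat_in_itvoo R t (t + e); first by rewrite ltrDl.
    rewrite !in_itv/= => /andP[tb be] /andP[ea at_].
    exists (a, b); rewrite /I/=; split; first by rewrite in_itv/= at_ tb.
    move=> s /=; rewrite in_itv/= => /andP[as_ sb].
    rewrite /ball/= ltr_norml; apply/andP; split; lra.
  have [i1 [x1 s1]] := itv x.1.1.
  have [i2 [x2 s2]] := itv x.1.2.
  have [i3 [x3 s3]] := itv x.2.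
  exists (i1, i2, i3) => //; case: pselect => [_ //|/= h].
  exfalso; apply: h => y [[y1 y2] y3]; apply: xeU.
  by split; [split; [exact: s1|exact: s2]|exact: s3].
apply: countable_bigcupT_measurable; first exact: countableP.
by move=> i; case: pselect => ? /=; [exact: box_meas|exact: measurable0].
Qed.

Lemma open_continuous_measurable (R : realType) (U : set (R * R * R))
    (f : R * R * R -> R) :
  open U -> (forall x, U x -> {for x, continuous f}) ->
  measurable_fun (U : set (mspace3 R)) f.
Proof.
move=> oU cf mU; apply: (measurability _ (RGenOInfty.measurableE R)) => //.
move=> _ [_ [a ->] <-]; apply: open3_measurable.
rewrite openE => x [Ux /=]; rewrite in_itv/= andbT => afx.
apply: filterI; first exact: open_nbhs_nbhs.
near=> y; rewrite /= in_itv/= andbT; near: y.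
by apply: (cf x Ux (fun z => a < z)); exact: lt_nbhsr.
Unshelve. all: by end_near. Qed.

(** A directional derivative only sees the function along one line, so it can be computed in any
    other space in which the restriction to a line is the same. This reduces derivatives in three
    variables to derivatives in one. *)
Lemma is_derive_transport (R : realType) (V V' : normedModType R)
    (f : V -> R) (g : V' -> R) (a v : V) (b w : V') (df : R) :
  (forall h : R, f (h *: v + a) = g (h *: w + b)) ->
  is_derive a v f df -> is_derive b w g df.
Proof.
move=> fg [fd fdf].
have e : (fun h : R => h^-1 *: ((f \o shift a) (h *: v) - f a)) =
         (fun h : R => h^-1 *: ((g \o shift b) (h *: w) - g b)).
  by apply/funext => h /=; rewrite fg; have := fg 0; rewrite !scale0r !add0r => ->.
apply: DeriveDef; first by rewrite /derivable -e.
by rewrite /derive -e.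
Qed.

(** Restriction to the line through [x] in direction [v] turns this into the chain rule in one
    variable; the inner function then needs a derivative in that direction only. *)
Lemma is_derive_chain (R : realType) (V : normedModType R) (h : R -> R)
    (g : V -> R) (x v : V) (dh dg : R) :
  is_derive (g x) 1 h dh -> is_derive x v g dg ->
  is_derive x v (h \o g) (dh * dg).
Proof.
move=> hdh gdg; pose k (t : R) := g (t *: v + x).
have kdg : is_derive (0 : R) 1 k dg.
  apply: is_derive_transport gdg => t.
  by rewrite /k addr0 [t *: 1]mulr1.
apply: (@is_derive_transport _ _ _ (h \o k) _ 0 1).
  by move=> t; rewrite /k/= addr0 [t *: 1]mulr1.
by apply: is_derive1_comp; rewrite /k scale0r add0r.
Qed.

Lemma continuous_norm_powR (R : realType) (a : R) : 0 < a ->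
  continuous (fun t : R => `|t| `^ a).
Proof.
move=> a0 t; have [->|t0] := eqVneq t 0; last first.
  apply: (@continuous_comp _ _ _ (fun t : R => `|t|) (@powR R ^~ a)).
    exact: norm_continuous.
  apply: differentiable_continuous; apply/derivable1_diffP.
  by apply: derivable_powR; rewrite in_itv/= andbT normr_gt0.
apply/cvgrPdist_lt => e e0; rewrite /= normr0 powR0 ?gt_eqF//.
have e1 : 0 < e `^ a^-1 by rewrite powR_gt0.
near=> s; rewrite sub0r normrN ger0_norm ?powR_ge0//.
have -> : e = (e `^ a^-1) `^ a by rewrite -powRrM mulVf ?gt_eqF// powRr1 ?ltW.
rewrite gt0_ltr_powR ?nnegrE ?powR_ge0//; near: s.
Unshelve. all: by end_near. Qed.

(** The difference quotient at 0 is bounded by [g], which tends to 0. This settles the exceptional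
    point 0 for |t|^p and for the squared positive part. *)
Lemma is_derive_squeeze0 (R : realType) (f g : R -> R) :
  f 0 = 0 -> g 0 = 0 -> {for 0, continuous g} ->
  (forall t, `|f t| <= `|t| * g t) -> is_derive (0 : R) 1 f 0.
Proof.
move=> f0 g0 gc fg.
have c : h^-1 *: ((f \o shift 0) (h *: 1) - f 0) @[h --> (0 : R)^'] --> (0 : R).
  apply/cvgrPdist_lt => e e0.
  have /cvgrPdist_lt/(_ e e0) := gc; rewrite g0 => /nbhs_dnbhs ge.
  near=> h; rewrite /= f0 addr0 subr0 sub0r normrN [h *: 1]mulr1 normrZ.
  have hn0 : h != 0 by near: h; exact: nbhs_dnbhs_neq.
  have : `|0 - g h| < e by near: h.
  rewrite sub0r normrN; apply: le_lt_trans.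
  rewrite normfV ler_pdivrMl ?normr_gt0//; apply: (le_trans (fg _)).
  by apply: ler_wpM2l => //; exact: ler_norm.
by apply: DeriveDef; [apply/cvg_ex; exists 0|exact: cvg_lim].
Unshelve. all: by end_near. Qed.

Definition dnorm_powR {R : realType} (p t : R) : R :=
  p * (Num.sg t * `|t| `^ (p - 1)).

Lemma is_derive_norm_powR (R : realType) (p t : R) : 1 < p ->
  is_derive t 1 (fun s : R => `|s| `^ p) (dnorm_powR p t).
Proof.
move=> p1; rewrite /dnorm_powR; have [t0|t0|->] := ltgtP t 0.
- have nt0 : 0 < - t by rewrite oppr_gt0.
  apply: (@near_eq_is_derive _ _ _ (fun s : R => (- s) `^ p)).
    near=> s; rewrite ltr0_norm//; near: s; exact: lt_nbhsl.
  have -> : p * (Num.sg t * `|t| `^ (p - 1)) = (p * (- t) `^ (p - 1)) * (-1).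
    by rewrite ltr0_sg// ltr0_norm//; ring.
  exact: (is_derive1_comp (is_derive1_powR p nt0) (is_deriveNid t 1)).
- apply: (@near_eq_is_derive _ _ _ (fun s : R => s `^ p)).
    near=> s; rewrite gtr0_norm//; near: s; exact: lt_nbhsr.
  by rewrite gtr0_sg// gtr0_norm// mul1r; exact: is_derive1_powR.
- rewrite sgr0 mul0r mulr0.
  apply: (@is_derive_squeeze0 _ _ (fun s : R => `|s| `^ (p - 1))).
  + by rewrite normr0 powR0// gt_eqF//; lra.
  + by rewrite normr0 powR0// gt_eqF//; lra.
  + by apply: continuous_norm_powR; lra.
  + move=> s; rewrite ger0_norm ?powR_ge0//.
    have [->|s0] := eqVneq s 0.
      by rewrite normr0 mul0r powR0// gt_eqF//; lra.
    rewrite -[X in _ <= X * _]powRr1// -powRD; last by rewrite normr_eq0 s0 implybT.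
    by rewrite addrC subrK.
Unshelve. all: by end_near. Qed.

Lemma continuous_dnorm_powR (R : realType) (p : R) : 1 < p ->
  continuous (dnorm_powR p).
Proof.
move=> p1 t; rewrite /dnorm_powR.
have c := @continuous_norm_powR R (p - 1) _ t.
apply: cvgM; first exact: cvg_cst.
have [t0|t0|->] := ltgtP t 0.
- apply: cvgM; last by apply: c; lra.
  apply: near_cst_continuous; near=> s; rewrite !ltr0_sg//.
  by near: s; exact: lt_nbhsl.
- apply: cvgM; last by apply: c; lra.
  apply: near_cst_continuous; near=> s; rewrite !gtr0_sg//.
  by near: s; exact: lt_nbhsr.
- rewrite sgr0 mul0r; apply/cvgr0Pnorm_lt => e e0.
  have /cvgrPdist_lt/(_ e e0) : {for 0, continuous (fun s : R => `|s| `^ (p - 1))}.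
    by apply: continuous_norm_powR; lra.
  rewrite normr0 powR0 ?gt_eqF//; last lra.
  apply: filterS => s; rewrite sub0r normrN; apply: le_lt_trans.
  by rewrite normrM; apply: ler_piMl => //; rewrite normr_sg; case: (s != 0).
Unshelve. all: by end_near. Qed.

(** Squaring removes the kink of the positive part at 0; this is what makes the cutoff continuously
    differentiable. *)
Lemma is_derive_sqr_pos (R : realType) (t : R) :
  is_derive t 1 (fun s : R => Num.max s 0 ^+ 2) (2 * Num.max t 0).
Proof.
have [t0|t0|->] := ltgtP t 0.
- apply: (@near_eq_is_derive _ _ _ (cst 0)); last first.
    by rewrite mulr0; exact: is_derive_cst.
  near=> s; have s0 : s < 0 by near: s; exact: lt_nbhsl.
  by rewrite max_r ?expr0n// ltW.
- apply: (@near_eq_is_derive _ _ _ (fun s : R => s ^+ 2)).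
    near=> s; have s0 : 0 < s by near: s; exact: lt_nbhsr.
    by rewrite max_l// ltW.
  have -> : 2 * t = t *: 1 + t *: 1 by rewrite [_ *: _]mulr1 mulr_natl.
  have -> : (fun s : R => s ^+ 2) = (fun s => s * s) by [].
  exact: is_deriveM.
- rewrite mulr0.
  apply: (@is_derive_squeeze0 _ _ (fun s : R => `|s|)).
  + by rewrite maxxx expr0n.
  + by rewrite normr0.
  + exact: norm_continuous.
  + move=> s; rewrite normrX expr2; case: (leP 0 s) => s0//.
    by rewrite normr0 mul0r mulr_ge0.
Unshelve. all: by end_near. Qed.

(** * Integration of partial derivatives *)

(** Both exhaustions are taken nondecreasing, so that a point of [F n] times [G k] lies in the
    rectangle of index [maxn n k]. *)
Lemma product_measure_sigma_finite d1 d2 (T1 : measurableType d1)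
    (T2 : measurableType d2) (R : realType)
    (m1 : {sigma_finite_measure set T1 -> \bar R})
    (m2 : {sigma_finite_measure set T2 -> \bar R}) :
  sigma_finite setT (m1 \x m2)%E.
Proof.
have /sigma_finiteP[F [TF ndF Foo]] := sigma_finiteT m1.
have /sigma_finiteP[G [TG ndG Goo]] := sigma_finiteT m2.
exists (fun n => F n `*` G n).
  rewrite -setXTT TF TG predeqE => -[x y]; split; last first.
    by move=> [n _ []/= ? ?]; split; exists n.
  move=> [/= [n _ Fnx] [k _ Gky]]; exists (maxn n k) => //; split.
    by move: x Fnx; exact/subsetPset/ndF/leq_maxl.
  by move: y Gky; exact/subsetPset/ndG/leq_maxr.
move=> k; have [? ?] := Foo k; have [? ?] := Goo k.
split; first exact: measurableX.
by rewrite product_measure1E// lte_mul_pinfty// ge0_fin_numE.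
Qed.

(* The canonical structures in the library stop at [{measure}] for [\x], which
   blocks Fubini for iterated products. *)
Definition sigma_finite_product d1 d2 (T1 : measurableType d1)
    (T2 : measurableType d2) (R : realType)
    (m1 : {sigma_finite_measure set T1 -> \bar R})
    (m2 : {sigma_finite_measure set T2 -> \bar R}) :
    {sigma_finite_measure set (T1 * T2)%type -> \bar R} :=
  HB.pack (m1 \x m2)%E (Measure_isSigmaFinite.Build _ _ _ (m1 \x m2)%E
    (product_measure_sigma_finite m1 m2)).

Lemma integral_prod_eq0l d1 d2 (T1 : measurableType d1) (T2 : measurableType d2)
    (R : realType) (m1 : {sigma_finite_measure set T1 -> \bar R})
    (m2 : {sigma_finite_measure set T2 -> \bar R}) (f : T1 * T2 -> \bar R) :
  (m1 \x m2)%E.-integrable setT f ->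
  (forall x, \int[m2]_y f (x, y) = 0)%E -> (\int[m1 \x m2]_z f z = 0)%E.
Proof.
by move=> fi f0; rewrite -integral12_prod_meas1//; apply: integral0_eq => x _; exact: f0.
Qed.

Lemma integral_prod_eq0r d1 d2 (T1 : measurableType d1) (T2 : measurableType d2)
    (R : realType) (m1 : {sigma_finite_measure set T1 -> \bar R})
    (m2 : {sigma_finite_measure set T2 -> \bar R}) (f : T1 * T2 -> \bar R) :
  (m1 \x m2)%E.-integrable setT f ->
  (forall y, \int[m1]_x f (x, y) = 0)%E -> (\int[m1 \x m2]_z f z = 0)%E.
Proof.
by move=> fi f0; rewrite -integral21_prod_meas1//; apply: integral0_eq => x _; exact: f0.
Qed.

Section triple_product.
Context d (T : measurableType d) (R : realType).
Variable m : {sigma_finite_measure set T -> \bar R}.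
Variable f : T * T * T -> \bar R.
Hypothesis fi : ((m \x m) \x m)%E.-integrable setT f.

Lemma integral3_eq0_3 : (forall y, \int[m]_t f (y, t) = 0)%E ->
  (\int[(m \x m) \x m]_z f z = 0)%E.
Proof. exact: (@integral_prod_eq0l _ _ _ _ R (sigma_finite_product m m) m f fi). Qed.

Hypothesis fi2 : forall z, (m \x m)%E.-integrable setT (fun y => f (y, z)).

(** The first two coordinates sit in the inner product, so Fubini is applied twice. The second
    application takes place on every slice with fixed third coordinate, hence the hypothesis
    [fi2]. *)
Lemma integral3_eq0_1 : (forall y z, \int[m]_t f (t, y, z) = 0)%E ->
  (\int[(m \x m) \x m]_z f z = 0)%E.
Proof.
move=> f0; apply: (@integral_prod_eq0r _ _ _ _ R (sigma_finite_product m m) m f fi) => z.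
by apply: (integral_prod_eq0r (fi2 z)) => y; exact: f0.
Qed.

Lemma integral3_eq0_2 : (forall x z, \int[m]_t f (x, t, z) = 0)%E ->
  (\int[(m \x m) \x m]_z f z = 0)%E.
Proof.
move=> f0; apply: (@integral_prod_eq0r _ _ _ _ R (sigma_finite_product m m) m f fi) => z.
by apply: (integral_prod_eq0l (fi2 z)) => x; exact: f0.
Qed.

End triple_product.

Lemma integral_derivative_compact_support (R : realType) (F F' : R -> R)
    (M : R) :
  (forall t, is_derive t (1 : R) F (F' t)) -> continuous F' ->
  (forall t, M < `|t| -> F t = 0 /\ F' t = 0) ->
  (\int[@lebesgue_measure R]_t (F' t)%:E = 0)%E.
Proof.
(* [N] exceeds both [M] and 0: the interval from [- N] to [N] is nondegenerate and [F] vanishes at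
   its endpoints. *)
move=> dF cF' F0; pose N : R := `|M| + 1.
have N0 : 0 < N by rewrite /N ltr_wpDl.
have MN : M < N by rewrite (le_lt_trans (ler_norm M))// ltrDl.
have cF : continuous F.
  move=> t; apply: differentiable_continuous; apply/derivable1_diffP.
  by have [] := dF t.
pose I : set R := `[- N, N]%classic.
transitivity (\int[@lebesgue_measure R]_(t in I) (F' t)%:E)%E.
  rewrite [RHS]integral_mkcond; apply: eq_integral => t _.
  rewrite /patch; case: ifPn => // /negP tN.
  rewrite (F0 t _).2//; apply: (lt_trans MN).
  rewrite ltNge ler_norml; apply/negP => tN'; apply: tN.
  by rewrite inE /I /= in_itv.
rewrite /I (@continuous_FTC2 R F' F).
- by rewrite (F0 N _).1 ?(F0 (- N) _).1 ?sube0// ?normrN gtr0_norm.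
- lra.
- exact: continuous_subspaceT.
- split.
  + by move=> t _; have [] := dF t.
  + by apply: cvg_at_right_filter; exact: cF.
  + by apply: cvg_at_left_filter; exact: cF.
- by move=> t _; rewrite derive1E; have [] := dF t.
Qed.

Lemma bounded_support_integrable d (T : measurableType d) (R : realType)
    (mu : {measure set T -> \bar R}) (D : set T) (f : T -> R) (C : R) :
  measurable D -> (mu D < +oo)%E -> measurable_fun setT f ->
  (forall x, `|f x| <= C) -> (forall x, ~ D x -> f x = 0) ->
  mu.-integrable setT (EFin \o f).
Proof.
move=> mD Dfin mf fC f0.
have -> : EFin \o f = (EFin \o f) \_ D.
  apply/funext => x; rewrite /patch; case: ifPn => //= /negP xD.
  by rewrite f0// => Dx; apply: xD; rewrite inE.
apply: (integrable_mkcond _ mD).1; apply: measurable_bounded_integrable => //.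
  exact: (measurable_funS measurableT (@subsetT _ D) mf).
exists C; split; first exact: num_real.
by move=> M CM x _; rewrite /= (le_trans (fC x))// ltW.
Qed.

Lemma continuous_compact_support_bounded (R : realType) (V : normedModType R)
    (K : set V) (B : V -> R) :
  compact K -> continuous B -> (forall x, ~ K x -> B x = 0) ->
  exists C, forall x, `|B x| <= C.
Proof.
move=> cK cB B0.
have /compact_bounded[C [_ BC]] : compact (B @` K).
  by apply: continuous_compact => //; exact: continuous_subspaceT.
exists (`|C| + 1) => x; have [Kx|nKx] := pselect (K x).
  by apply: BC; [rewrite (le_lt_trans (ler_norm C))// ltrDl|exists x].
by rewrite B0// normr0 addr_ge0.
Qed.

Definition cube2 {R : realType} (M : R) : set (R * R) :=
  `[- M, M]%classic `*` `[- M, M]%classic.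

Definition cube3 {R : realType} (M : R) : set (R * R * R) :=
  cube2 M `*` `[- M, M]%classic.

Lemma lebesgue_itv_lty (R : realType) (a b : R) :
  (@lebesgue_measure R `[a, b]%classic < +oo)%E.
Proof. by rewrite lebesgue_measure_itv/=; case: ifP => _; rewrite ?ltry. Qed.

Lemma cube2_measurable (R : realType) (M : R) : measurable (cube2 M : set (measurableTypeR R * measurableTypeR R)).
Proof. by apply: measurableX; exact: measurable_itv. Qed.

Lemma cube3_measurable (R : realType) (M : R) : measurable (cube3 M : set (mspace3 R)).
Proof.
by apply: measurableX; [exact: cube2_measurable|exact: measurable_itv].
Qed.

Lemma cube2_lty (R : realType) (M : R) :
  ((@lebesgue_measure R \x @lebesgue_measure R) (cube2 M) < +oo)%E.
Proof.
rewrite product_measure1E; [|exact: measurable_itv..].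
by rewrite lte_mul_pinfty ?ge0_fin_numE ?lebesgue_itv_lty.
Qed.

Lemma cube3_lty (R : realType) (M : R) : (lebesgue3 R (cube3 M) < +oo)%E.
Proof.
rewrite /lebesgue3 product_measure1E; [|exact: cube2_measurable|exact: measurable_itv].
by rewrite lte_mul_pinfty ?ge0_fin_numE ?lebesgue_itv_lty ?cube2_lty.
Qed.

Lemma compact_sub_cube3 (R : realType) (K : set (R * R * R)) :
  compact K -> exists M, K `<=` cube3 M.
Proof.
move=> /compact_bounded[C [_ KC]]; exists (`|C| + 1) => x Kx.
have := KC (`|C| + 1) _ x Kx.
rewrite (le_lt_trans (ler_norm C)) ?ltrDl// => /(_ isT).
rewrite /= !prod_normE/= !ge_max => /andP[/andP[h1 h2] h3].
by split; [split|]; rewrite /= in_itv/= -ler_norml.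
Qed.

Lemma for_continuous_pair (T U V : topologicalType) (f : T -> U) (g : T -> V)
    (x : T) :
  {for x, continuous f} -> {for x, continuous g} ->
  {for x, continuous (fun t => (f t, g t))}.
Proof. by move=> cf cg; exact: (cvg_pair cf cg). Qed.

Lemma integral_partial_compact_support (R : realType) (i : 'I_3)
    (K : set (R * R * R)) (G B : R * R * R -> R) :
  compact K -> (forall x, is_derive x (basis3 R i) G (B x)) -> continuous B ->
  (forall x, ~ K x -> G x = 0 /\ B x = 0) ->
  (lebesgue3 R).-integrable setT (EFin \o B) /\
  (\int[lebesgue3 R]_x (B x)%:E = 0)%E.
Proof.
move=> cK dG cB GB0.
have [M KM] := compact_sub_cube3 cK.
have [C BC] := continuous_compact_support_bounded cK cB (fun x h => (GB0 x h).2).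
have off x : ~ cube3 M x -> G x = 0 /\ B x = 0 by move=> h; apply: GB0 => /KM.
have mB : measurable_fun [set: mspace3 R] B by apply: open_continuous_measurable => [|x _]; [exact: openT|exact: cB].
have iB : (lebesgue3 R).-integrable setT (EFin \o B).
  apply: (bounded_support_integrable (cube3_measurable M) (cube3_lty M) mB BC).
  by move=> x /off[].
split=> //.
have iB2 z : (@lebesgue_measure R \x @lebesgue_measure R)%E.-integrable setT
    (EFin \o (fun y => B (y, z))).
  apply: (bounded_support_integrable (cube2_measurable M) (cube2_lty M)) => //.
  - exact: measurable_fun_pair1 mB.
  - by move=> y nMy; apply: (off _ _).2 => -[].
(* Here [g] parametrises a line parallel to the [i]-th axis; this form treats the three coordinate
   directions at once. *)
have lineE (g : R -> R * R * R) : (forall t, M < `|t| -> ~ cube3 M (g t)) ->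
    continuous g -> (forall h t, g (h + t) = h *: basis3 R i + g t) ->
    (\int[@lebesgue_measure R]_t (B (g t))%:E = 0)%E.
  move=> gM cg gD.
  apply: (@integral_derivative_compact_support R (G \o g) (B \o g) M).
  - move=> t; apply: (is_derive_transport _ (dG (g t))) => h.
    by rewrite /= -gD [h *: 1]mulr1.
  - by move=> t; apply: continuous_comp; [exact: cg|exact: cB].
  - by move=> t /gM/off.
have out (t : R) : M < `|t| -> ~ (`[- M, M]%classic : set R) t.
  by rewrite ltNge => /negP h; rewrite /= in_itv/= -ler_norml.
case: i dG lineE => -[|[|[|//]]] i3 dG lineE.
- apply: (@integral3_eq0_1 _ _ R (@lebesgue_measure R) (EFin \o B) iB iB2) => y z.
  apply: (lineE (fun t => (t, y, z))) => [t /out h [[]]//|t|h t].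
    by apply: for_continuous_pair; [apply: for_continuous_pair; [exact: cvg_id|exact: cvg_cst]|exact: cvg_cst].
  by congr (_, _, _); rewrite /= ?[h *: _]mulr1 ?[h *: _]mulr0 ?add0r.
- apply: (@integral3_eq0_2 _ _ R (@lebesgue_measure R) (EFin \o B) iB iB2) => x z.
  apply: (lineE (fun t => (x, t, z))) => [t /out h [[]]//|t|h t].
    by apply: for_continuous_pair; [apply: for_continuous_pair; [exact: cvg_cst|exact: cvg_id]|exact: cvg_cst].
  by congr (_, _, _); rewrite /= ?[h *: _]mulr1 ?[h *: _]mulr0 ?add0r.
- apply: (@integral3_eq0_3 _ _ R (@lebesgue_measure R) (EFin \o B) iB) => y.
  apply: (lineE (fun t => (y, t))) => [t /out h []//|t|h t].
    by apply: for_continuous_pair; [exact: cvg_cst|exact: cvg_id].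
  by case: y => a b; congr (_, _, _); rewrite /= ?[h *: _]mulr1 ?[h *: _]mulr0 ?add0r.
Qed.

(** A compact [K] is closed, so off [K] both functions vanish on a neighbourhood and are regular
    there. Asking for regularity on [K] alone matters because the flux is singular at the core
    circle and at the boundary. *)
Lemma integral_partial_local (R : realType) (i : 'I_3)
    (K : set (R * R * R)) (G B : R * R * R -> R) :
  compact K -> (forall x, K x -> is_derive x (basis3 R i) G (B x)) ->
  (forall x, K x -> {for x, continuous B}) ->
  (forall x, ~ K x -> G x = 0 /\ B x = 0) ->
  (lebesgue3 R).-integrable setT (EFin \o B) /\
  (\int[lebesgue3 R]_x (B x)%:E = 0)%E.
Proof.
move=> cK dG cB GB0.
have nearK x : ~ K x -> \forall y \near x, ~ K y.
  move=> nKx; have /closed_openC oK : closed K by apply: compact_closed => //; exact: norm_hausdorff.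
  exact: (open_nbhs_nbhs (conj oK nKx)).
apply: (@integral_partial_compact_support _ i K G) => //.
- move=> x; have [Kx|nKx] := pselect (K x); first exact: dG.
  rewrite (GB0 x nKx).2; apply: (@near_eq_is_derive _ _ _ (cst 0)).
  by apply: filterS (nearK x nKx) => y /GB0[].
- move=> x; have [Kx|nKx] := pselect (K x); first exact: cB.
  apply: (@near_cst_continuous _ _ 0).
  by apply: filterS (nearK x nKx) => y /GB0[].
Qed.

(** * Removing the cutoff and comparing domains of integration *)

Section measure_toolbox.
Context d (T : measurableType d) (R : realType) (mu : {measure set T -> \bar R}).

Lemma integrable_sum_eq0 (n : nat) (g : 'I_n -> T -> R) :
  (forall i, mu.-integrable setT (EFin \o g i) /\
             (\int[mu]_x (g i x)%:E = 0)%E) ->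
  mu.-integrable setT (EFin \o (fun x => \sum_(i < n) g i x)) /\
  (\int[mu]_x (\sum_(i < n) g i x)%:E = 0)%E.
Proof.
elim: n g => [|n ih] g gi.
  have -> : EFin \o (fun x : T => \sum_(i < 0) g i x) = cst 0%E.
    by apply/funext => x /=; rewrite big_ord0.
  split; first exact: integrable0.
  by rewrite integral0_eq// => x _; rewrite big_ord0.
have [i1 e1] := ih (fun i => g (lift ord0 i)) (fun i => gi _).
have sE : EFin \o (fun x => \sum_(i < n.+1) g i x) =
    ((EFin \o g ord0) \+ (EFin \o (fun x => (\sum_(i < n) g (lift ord0 i) x)%R)))%E.
  by apply/funext => x /=; rewrite big_ord_recl EFinD.
split; first by rewrite sE; apply: integrableD => //; exact: (gi ord0).1.
have -> : (\int[mu]_x (\sum_(i < n.+1) g i x)%:E =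
    \int[mu]_x (EFin \o (fun x => (\sum_(i < n.+1) g i x)%R)) x)%E by [].
rewrite sE integralD//; last exact: (gi ord0).1.
by rewrite (gi ord0).2 e1 adde0.
Qed.

Lemma integral_restrict_eq0 (D : set T) (g : T -> R) :
  measurable D -> (forall x, ~ D x -> g x = 0) ->
  mu.-integrable setT (EFin \o g) -> (\int[mu]_x (g x)%:E = 0)%E ->
  mu.-integrable D (EFin \o g) /\ (\int[mu]_(x in D) (g x)%:E = 0)%E.
Proof.
move=> mD g0 ig eg.
have rE : (EFin \o g) \_ D = EFin \o g.
  apply/funext => x; rewrite /patch; case: ifPn => // /negP xD.
  by rewrite /= g0// => Dx; apply: xD; rewrite inE.
split; first by apply/(integrable_mkcond _ mD); rewrite rE.
by rewrite integral_mkcond rE.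
Qed.

(** Integrating the pointwise bound kills the divergence [W n] and leaves the integral of
    [eta n * F] below that of [b], uniformly in [n]; monotone convergence does the rest. *)
Lemma integral_le_of_cutoff (U : set T) (eta W : nat -> T -> R) (F b : T -> R)
    (k : R) :
  measurable U ->
  (forall n, measurable_fun U (eta n)) -> measurable_fun U F ->
  measurable_fun U b ->
  (forall n x, U x -> 0 <= eta n x) -> (forall x, U x -> 0 <= F x) ->
  (forall x, U x -> 0 <= b x) ->
  (forall x, U x -> {homo eta^~ x : n m / (n <= m)%N >-> n <= m}) ->
  (forall x, U x -> eta^~ x @ \oo --> (1 : R)) ->
  (forall n, mu.-integrable U (EFin \o W n)) ->
  (forall n, (\int[mu]_(x in U) (W n x)%:E = 0)%E) ->
  (forall n x, U x -> eta n x * F x <= k * W n x + b x) ->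
  (\int[mu]_(x in U) (F x)%:E <= \int[mu]_(x in U) (b x)%:E)%E.
Proof.
move=> mU meta mF mb eta0 F0 b0 nd cvg1 iW eW le.
have mb' : measurable_fun U (EFin \o b) by exact/measurable_EFinP.
(* If the right-hand side is infinite there is nothing to prove. Otherwise [b] is integrable, and
   the integral can be split along a sum containing the signed term [W n]. *)
have [bfin|] := ltP (\int[mu]_(x in U) (b x)%:E)%E +oo%E; last first.
  by rewrite leye_eq => /eqP ->; rewrite leey.
have ib : mu.-integrable U (EFin \o b).
  apply/integrableP; split => //.
  rewrite (eq_integral (EFin \o b))// => x; rewrite inE => Ux.
  by rewrite /= ger0_norm// b0.
pose g n x := (eta n x * F x)%:E.
have mg n : measurable_fun U (g n).
  by apply/measurable_EFinP; apply: measurable_funM.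
have g0 n x : U x -> (0 <= g n x)%E.
  by move=> Ux; rewrite lee_fin mulr_ge0// ?eta0// F0.
have ndg x : U x -> {homo g^~ x : n m / (n <= m)%N >-> (n <= m)%E}.
  by move=> Ux n m nm; rewrite lee_fin ler_wpM2r ?F0// nd.
have limg x : U x -> limn (g^~ x) = (F x)%:E.
  move=> Ux; apply/cvg_lim => //; apply: cvg_EFin; first by near=> n.
  rewrite -[X in _ --> X]mul1r; apply: cvgM; first exact: cvg1.
  exact: cvg_cst.
rewrite -(eq_integral _ _ (fun x => limg x \o set_mem)).
rewrite monotone_convergence//; apply: lime_le.
  apply/cvg_ex; eexists; exact: (cvg_monotone_convergence mU mg g0 ndg).
near=> n.
have iS : mu.-integrable U (fun x => k%:E * (W n x)%:E + (b x)%:E)%E.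
  by apply: integrableD => //; apply: integrableZl => //; exact: iW.
have -> : (\int[mu]_(x in U) (b x)%:E =
    \int[mu]_(x in U) (k%:E * (W n x)%:E + (b x)%:E))%E.
  rewrite integralD//; last by apply: integrableZl => //; exact: iW.
  by rewrite integralZl ?eW ?mule0 ?add0e//; exact: iW.
have [mS _] := integrableP _ _ _ iS.
apply: (ge0_le_integral mu mU (g0 n) (mg n) mS) => x Ux.
by rewrite -EFinM -EFinD lee_fin le.
Unshelve. all: by end_near. Qed.

(* No measurability is needed: the integral of a nonnegative function is a
   supremum over the simple functions below it. *)
Lemma le_integral_restrict (U D : set T) (b : T -> \bar R) :
  U `<=` D -> (forall x, D x -> (0 <= b x)%E) ->
  (\int[mu]_(x in U) b x <= \int[mu]_(x in D) b x)%E.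
Proof.
move=> UD b0; rewrite [leLHS]integral_mkcond [leRHS]integral_mkcond.
rewrite !ge0_integralTE; last 2 first.
- by move=> x; apply: erestrict_ge0.
- by move=> x; apply: erestrict_ge0 => y /UD; exact: b0.
apply: le_ereal_sup => _ [h /= hb <-]; exists h => //= x.
apply: (le_trans (hb x)); rewrite /patch; case: ifPn => xU.
  by rewrite ifT// inE; apply: UD; rewrite inE in xU.
by case: ifPn => //; rewrite inE; exact: b0.
Qed.

(** The integral is by definition that of the positive part minus that of the negative part, so the
    bound holds for any [f], measurable or not. *)
Lemma integral_le_funepos (D : set T) (f : T -> \bar R) :
  (\int[mu]_(x in D) f x <= \int[mu]_(x in D) f^\+ x)%E.
Proof.
rewrite [leLHS]integralE -[leRHS]adde0; apply: leeD2l.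
by rewrite oppe_le0; apply: integral_ge0.
Qed.

(** To be read with [U] the torus without its core circle and [D] the full torus. Removing a null
    set does not change the integral of [A]; the positive part of [B] on [D] already lives on [U];
    and the integral of [b] grows with the domain. *)
Lemma integral_le_punctured (U D : set T) (A B : T -> R) (b : T -> \bar R)
    (k1 k2 : R) :
  measurable U -> measurable D -> U `<=` D -> mu (D `\` U) = 0%E ->
  0 <= k1 -> 0 <= k2 ->
  measurable_fun D A -> (forall x, D x -> 0 <= A x) ->
  measurable_fun U B -> (forall x, U x -> 0 <= B x) ->
  (forall x, (D `\` U) x -> B x <= 0) ->
  (forall x, D x -> (0 <= b x)%E) ->
  (\int[mu]_(x in U) (k1 * A x + k2 * B x)%:E <= \int[mu]_(x in U) b x)%E ->
  (k1%:E * \int[mu]_(x in D) (A x)%:E + k2%:E * \int[mu]_(x in D) (B x)%:E <=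
   \int[mu]_(x in D) b x)%E.
Proof.
move=> mU mD UD DU0 k10 k20 mA A0 mB B0 BN b0 le.
have mUA : measurable_fun U A by exact: measurable_funS mA.
have AE : (\int[mu]_(x in D) (A x)%:E = \int[mu]_(x in U) (A x)%:E)%E.
  rewrite (@ge0_negligible_integral _ _ _ mu D (D `\` U))//.
  - by rewrite setDD setIC; congr integral; apply/setIidPl.
  - exact: measurableD.
  - exact/measurable_EFinP.
have BE : (\int[mu]_(x in D) (B x)%:E <= \int[mu]_(x in U) (B x)%:E)%E.
  apply: (le_trans (integral_le_funepos _ _)).
  rewrite le_eqVlt; apply/orP; left; apply/eqP.
  rewrite integral_mkcond [RHS]integral_mkcond; congr integral.
  apply/funext => x; rewrite /patch funeposE.
  case: ifPn => xD; case: ifPn => xU //.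
  - by rewrite inE in xU; rewrite max_l// lee_fin B0.
  - rewrite inE in xD; rewrite notin_setE in xU.
    by rewrite max_r// lee_fin BN.
  - by move: xU xD; rewrite inE => /UD Dx; rewrite notin_setE.
apply: (@le_trans _ _ (k1%:E * \int[mu]_(x in U) (A x)%:E +
    k2%:E * \int[mu]_(x in U) (B x)%:E)%E).
  by rewrite AE; apply: leeD2l; apply: lee_wpmul2l => //; rewrite lee_fin.
have A0' x : U x -> (0 <= (A x)%:E)%E by move=> Ux; rewrite lee_fin A0//; exact: UD.
have B0' x : U x -> (0 <= (B x)%:E)%E by move=> Ux; rewrite lee_fin B0.
have mA' : measurable_fun U (fun x => (A x)%:E) by exact/measurable_EFinP.
have mB' : measurable_fun U (fun x => (B x)%:E) by exact/measurable_EFinP.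
have mkA : measurable_fun U (fun x => k1%:E * (A x)%:E)%E.
  by apply/measurable_EFinP; exact: measurable_funM.
have mkB : measurable_fun U (fun x => k2%:E * (B x)%:E)%E.
  by apply/measurable_EFinP; exact: measurable_funM.
have kA0 x : U x -> (0 <= k1%:E * (A x)%:E)%E by move=> /A0' ?; exact: mule_ge0.
have kB0 x : U x -> (0 <= k2%:E * (B x)%:E)%E by move=> /B0' ?; exact: mule_ge0.
rewrite -(ge0_integralZl mu mU mA' A0')// -(ge0_integralZl mu mU mB' B0')//.
rewrite -(ge0_integralD mu mU kA0 mkA kB0 mkB).
exact: (le_trans le (le_integral_restrict UD b0)).
Qed.

End measure_toolbox.

(** * Geometry of the solid torus *)

Definition axdist {R : realType} (x : R * R * R) : R :=
  Num.sqrt (x.1.1 ^+ 2 + x.1.2 ^+ 2).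

(** The distance to the core circle of radius [c], computed in the half-plane through [x] bounded by
    the axis. *)
Definition cdist {R : realType} (c : R) (x : R * R * R) : R :=
  Num.sqrt ((axdist x - c) ^+ 2 + x.2 ^+ 2).

Lemma sqr_sqrtD (R : realType) (a b : R) :
  Num.sqrt (a ^+ 2 + b ^+ 2) ^+ 2 = a ^+ 2 + b ^+ 2.
Proof. by rewrite sqr_sqrtr// addr_ge0// sqr_ge0. Qed.

Lemma cauchy_schwarz2 (R : realType) (a b c d : R) :
  a * c + b * d <= Num.sqrt (a ^+ 2 + b ^+ 2) * Num.sqrt (c ^+ 2 + d ^+ 2).
Proof.
rewrite -sqrtrM ?addr_ge0 ?sqr_ge0//; apply: (le_trans (ler_norm _)).
by rewrite -sqrtr_sqr ler_wsqrtr//; have := sqr_ge0 (a * d - b * c); lra.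
Qed.

Lemma minkowski2 (R : realType) (a b c d : R) :
  Num.sqrt ((a + c) ^+ 2 + (b + d) ^+ 2) <=
  Num.sqrt (a ^+ 2 + b ^+ 2) + Num.sqrt (c ^+ 2 + d ^+ 2).
Proof.
rewrite -(@ler_pXn2r _ 2) ?nnegrE ?addr_ge0 ?sqrtr_ge0//.
rewrite sqr_sqrtD [leRHS]sqrrD !sqr_sqrtD.
have := cauchy_schwarz2 a b c d; lra.
Qed.

Lemma enormE (R : realType) (u : R * R * R) :
  enorm u = Num.sqrt (u.1.1 ^+ 2 + u.1.2 ^+ 2 + u.2 ^+ 2).
Proof. by rewrite /enorm /dot -!expr2. Qed.

(** The map to the half-plane that sends [x] to [(axdist x, x.2)] is 1-Lipschitz by Cauchy-Schwarz
    in the horizontal plane, and the distance to a point of the half-plane is 1-Lipschitz by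
    Minkowski. *)
Lemma cdist_lipschitz (R : realType) (c : R) (x y : R * R * R) :
  cdist c x <= cdist c y + enorm (x - y).
Proof.
have -> : cdist c x = Num.sqrt ((axdist y - c + (axdist x - axdist y)) ^+ 2 +
    (y.2 + (x.2 - y.2)) ^+ 2) by congr (Num.sqrt (_ ^+ 2 + _ ^+ 2)); ring.
apply: (le_trans (minkowski2 _ _ _ _)); rewrite lerD2l enormE ler_wsqrtr//=.
rewrite lerD2r sqrrB !sqr_sqrtD.
have := cauchy_schwarz2 x.1.1 x.1.2 y.1.1 y.1.2; rewrite /axdist; lra.
Qed.

Lemma continuous_axdist (R : realType) : continuous (@axdist R).
Proof.
move=> x; apply: (@continuous_comp _ _ _
  (fun x : R * R * R => x.1.1 ^+ 2 + x.1.2 ^+ 2) Num.sqrt).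
  have c1 : {for x, continuous (fun x : R * R * R => x.1.1)}.
    by apply: (@continuous_comp _ _ _ fst fst); exact: cvg_fst.
  have c2 : {for x, continuous (fun x : R * R * R => x.1.2)}.
    by apply: (@continuous_comp _ _ _ fst snd); [exact: cvg_fst|exact: cvg_snd].
  exact: (cvgD (cvgM c1 c1) (cvgM c2 c2)).
exact: sqrt_continuous.
Qed.

Lemma continuous_cdist (R : realType) (c : R) : continuous (cdist c).
Proof.
move=> x; apply: (@continuous_comp _ _ _
  (fun x : R * R * R => (axdist x - c) ^+ 2 + x.2 ^+ 2) Num.sqrt).
  have c1 : {for x, continuous (fun x : R * R * R => axdist x - c)}.
    exact: (cvgB (@continuous_axdist R x) (cvg_cst c)).
  have c2 : {for x, continuous (fun x : R * R * R => x.2)} by exact: cvg_snd.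
  exact: (cvgD (cvgM c1 c1) (cvgM c2 c2)).
exact: sqrt_continuous.
Qed.

Lemma axdist_ge0 (R : realType) (x : R * R * R) : 0 <= axdist x.
Proof. exact: sqrtr_ge0. Qed.

Lemma cdist_ge0 (R : realType) (c : R) (x : R * R * R) : 0 <= cdist c x.
Proof. exact: sqrtr_ge0. Qed.

Lemma axdist_cdist (R : realType) (c : R) (x : R * R * R) :
  `|axdist x - c| <= cdist c x.
Proof. by rewrite -sqrtr_sqr ler_wsqrtr// lerDl sqr_ge0. Qed.

Lemma polar2 (R : realType) (a b : R) :
  exists phi : R, a = Num.sqrt (a ^+ 2 + b ^+ 2) * cos phi /\
                  b = Num.sqrt (a ^+ 2 + b ^+ 2) * sin phi.
Proof.
set s := Num.sqrt _.
have s0 : 0 <= s by exact: sqrtr_ge0.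
have s2 : s ^+ 2 = a ^+ 2 + b ^+ 2 by exact: sqr_sqrtD.
have [sz|sn0] := eqVneq s 0.
  exists 0; rewrite sz !mul0r; move: s2; rewrite sz expr0n/= => /esym/eqP.
  by rewrite paddr_eq0 ?sqr_ge0// !sqrf_eq0 => /andP[/eqP-> /eqP->].
have sgt0 : 0 < s by rewrite lt_def sn0.
have h : (a / s) ^+ 2 + (b / s) ^+ 2 = 1.
  by rewrite !expr_div_n -mulrDl -s2 divff// expf_neq0.
have a1 : -1 <= a / s <= 1.
  by rewrite -ler_norml -(@ler_pXn2r _ 2) ?nnegrE// expr1n -normrX ger0_norm ?sqr_ge0//;
    have := sqr_ge0 (b / s); lra.
have ca : cos (acos (a / s)) = a / s by exact: acosK.
have sa : sin (acos (a / s)) = `|b / s|.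
  by rewrite sin_acos// -sqrtr_sqr; congr Num.sqrt; lra.
have [b0|b0] := leP 0 (b / s).
  exists (acos (a / s)); rewrite ca sa ger0_norm//.
  by split; rewrite mulrC divfK.
exists (- acos (a / s)); rewrite cosN sinN ca sa ltr0_norm// opprK.
by split; rewrite mulrC divfK.
Qed.

Lemma solid_torusE (R : realType) (r c : R) : r < c ->
  solid_torus r c = [set x | cdist c x < r].
Proof.
move=> rc; apply/seteqP; split=> [x [phi _ [z [z2 zr] <-]]|x /= xr].
  have zE : enorm (z - (c, 0, 0)) = Num.sqrt ((z.1.1 - c) ^+ 2 + z.2 ^+ 2).
    by rewrite enormE/= z2 !subr0 expr0n/= addr0.
  (* The disc does not reach the axis because [r < c]. Hence the axial distance of the rotated point
     is [z.1.1] itself and not merely its absolute value. *)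
  have z1 : 0 < z.1.1.
    have : `|z.1.1 - c| < r.
      apply: le_lt_trans zr; rewrite zE -sqrtr_sqr ler_wsqrtr// lerDl sqr_ge0//.
    by rewrite ltr_norml; lra.
  rewrite /= /cdist; suff -> : axdist (rotate3 phi z) = z.1.1 by rewrite -zE.
  rewrite /axdist/= z2 -[RHS]gtr0_norm// -sqrtr_sqr; congr Num.sqrt.
  have := cos2Dsin2 phi; rewrite !mulr0 subr0 addr0 !exprMn -mulrDl => ->.
  by rewrite mul1r.
have [phi [x1 x2]] := polar2 x.1.1 x.1.2.
exists phi => //; exists (axdist x, 0, x.2).
  by split=> //; rewrite enormE/= !subr0 expr0n/= addr0.
case: x x1 x2 {xr} => -[x1 x2] x3 /= e1 e2.
rewrite /rotate3/= !mulr0 subr0 addr0; congr (_, _, _).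
  by rewrite [RHS]e1 mulrC.
by rewrite [RHS]e2 mulrC.
Qed.

(* The point at signed distance [s] from the core circle, in the direction
   [(a, b)] of the half-plane through [x] bounded by the axis. *)
Definition core_ray {R : realType} (c : R) (x : R * R * R) (a b s : R) :
    R * R * R :=
  ((c + s * a) / axdist x * x.1.1, (c + s * a) / axdist x * x.1.2, s * b).

(** The condition [0 <= c + s * a] says that the ray has not crossed the axis, so that [c + s * a]
    is the axial distance of its point. *)
Lemma cdist_core_ray (R : realType) (c : R) (x : R * R * R) (a b s : R) :
  0 < axdist x -> a ^+ 2 + b ^+ 2 = 1 -> 0 <= c + s * a ->
  cdist c (core_ray c x a b s) = `|s|.
Proof.
move=> x0 ab cs; rewrite /cdist.
have -> : axdist (core_ray c x a b s) = c + s * a.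
  rewrite /axdist/= !exprMn -mulrDr -(sqr_sqrtD x.1.1) -/(axdist x) -!exprMn.
  by rewrite mulrVK ?unitfE ?gt_eqF// sqrtr_sqr ger0_norm.
by rewrite -sqrtr_sqr; congr Num.sqrt; rewrite /= -[RHS]mulr1 -ab; ring.
Qed.

Lemma enorm_core_ray (R : realType) (c : R) (x : R * R * R) (a b s t : R) :
  0 < axdist x -> a ^+ 2 + b ^+ 2 = 1 ->
  enorm (core_ray c x a b s - core_ray c x a b t) = `|s - t|.
Proof.
move=> x0 ab; rewrite enormE -sqrtr_sqr; congr Num.sqrt.
have -> : (s - t) ^+ 2 = ((s - t) * a / axdist x) ^+ 2 * axdist x ^+ 2 +
                         ((s - t) * b) ^+ 2.
  rewrite -exprMn mulrVK ?unitfE ?gt_eqF//.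
  by rewrite -[LHS]mulr1 -ab; ring.
by rewrite /axdist sqr_sqrtD /=; ring.
Qed.

Lemma core_ray_exists (R : realType) (c : R) (x : R * R * R) : 0 < axdist x ->
  exists a b, a ^+ 2 + b ^+ 2 = 1 /\ x = core_ray c x a b (cdist c x).
Proof.
move=> x0; have [phi [h1 h2]] := polar2 (axdist x - c) x.2.
exists (cos phi), (sin phi); split; first exact: cos2Dsin2.
rewrite /core_ray -h1 -h2 addrC subrK divff ?gt_eqF// !mul1r.
by case: x {x0 h1 h2} => -[].
Qed.

Section torus_geometry.
Context (R : realType) (r c : R) (r_gt0 : 0 < r) (r_ltc : r < c).
Let Omega := solid_torus r c.

Lemma axdist_gt0 (x : R * R * R) : cdist c x <= r -> 0 < axdist x.
Proof.
move=> xr; have := axdist_cdist c x; have := r_ltc.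
by rewrite ler_norml; lra.
Qed.

Lemma solid_torus_open : open Omega.
Proof.
rewrite /Omega solid_torusE//.
have -> : [set x : R * R * R | cdist c x < r] = cdist c @^-1` [set t | t < r] by [].
by apply: open_comp; [move=> x _; exact: continuous_cdist|exact: open_lt].
Qed.

Lemma frontier_solid_torus : frontier Omega = [set x | cdist c x = r].
Proof.
rewrite /frontier; have /interior_id -> := solid_torus_open.
rewrite /Omega solid_torusE//; apply/seteqP; split=> [x [clx /= /negP]|x /= xr].
  rewrite -leNgt => xr; apply/eqP; rewrite eq_le xr andbT.
  have cl : closed [set x : R * R * R | cdist c x <= r].
    have -> : [set x : R * R * R | cdist c x <= r] = cdist c @^-1` [set t | t <= r] by [].
    by apply: closed_comp; [move=> y _; exact: continuous_cdist|exact: closed_le].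
  apply: cl; apply: closure_subset clx => y /=; exact: ltW.
split; last by rewrite xr ltxx.
have x0 : 0 < axdist x by apply: axdist_gt0; rewrite xr.
(* The point is approached from inside along its own ray from the core, as [s] tends to [r] from the
   left; [-1 <= a] and [r < c] keep this ray off the axis. *)
have [a [b [ab xE]]] := core_ray_exists c x0.
have a1 : -1 <= a.
  by rewrite lerNl; have := sqr_ge0 b; have := sqr_ge0 (a - 1); nra.
move=> B Bx.
have cray : {for r, continuous (core_ray c x a b)}.
  have lin (k l : R) : {for r, continuous (fun s : R => (c + s * k) / axdist x * l)}.
    apply: cvgM; last exact: cvg_cst.
    apply: cvgM; last exact: cvg_cst.
    apply: cvgD; first exact: cvg_cst.
    by apply: cvgM; [exact: cvg_id|exact: cvg_cst].
  apply: for_continuous_pair; first by apply: for_continuous_pair; exact: lin.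
  by apply: cvgM; [exact: cvg_id|exact: cvg_cst].
have rB : \forall s \near r, B (core_ray c x a b s).
  by apply: cray; rewrite -[X in core_ray c x a b X]xr -xE.
have : \forall s \near r^'-, B (core_ray c x a b s) by exact: cvg_at_left_filter rB.
move=> rB'.
near (r^'-) => s.
exists (core_ray c x a b s); split; last by near: s.
have s0 : 0 <= s by near: s; exact: nbhs_left_ge.
have sr : s < r by near: s; exact: nbhs_left_lt.
rewrite /= cdist_core_ray// ?ger0_norm//.
by have := r_ltc; nra.
Unshelve. all: by end_near. Qed.

Lemma bdist_solid_torus (x : R * R * R) : Omega x -> bdist Omega x = r - cdist c x.
Proof.
move=> Ox; have xr : cdist c x < r by move: Ox; rewrite /Omega solid_torusE.
rewrite /bdist frontier_solid_torus; set S := [set _ | _ in _].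
have lb : lbound S (r - cdist c x).
  move=> _ [y /= yr <-]; rewrite lerBlDl -yr.
  have -> : enorm (x - y) = enorm (y - x).
    by rewrite !enormE /=; congr Num.sqrt; ring.
  exact: cdist_lipschitz.
have x0 : 0 < axdist x by apply: axdist_gt0; exact: ltW.
have [a [b [ab xE]]] := core_ray_exists c x0.
have a1 : -1 <= a.
  by rewrite lerNl; have := sqr_ge0 b; have := sqr_ge0 (a - 1); nra.
have cra : 0 <= c + r * a.
  have : 0 <= r * (a + 1) by apply: mulr_ge0; [exact: ltW|lra].
  have := r_ltc; lra.
(* The lower bound is attained where the ray from the core through [x] meets the boundary. *)
have Sx : S (r - cdist c x).
  exists (core_ray c x a b r).
    by rewrite /= cdist_core_ray// gtr0_norm.
  by rewrite {1}xE enorm_core_ray// distrC gtr0_norm// subr_gt0.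
apply/eqP; rewrite eq_le; apply/andP; split.
  exact: (ge_inf (ex_intro _ _ lb) Sx).
exact: (lb_le_inf (ex_intro _ _ Sx) lb).
Qed.

(** Start from the point [y] of the outer equator next to [x] and move through [x]. At [x] all
    points of the boundary circle of the cross-section are equally near; beyond [x] the opposite
    point, on the inner equator, is strictly nearer than [y]. So [t = 1] is the last admissible
    position. This inclusion carries claims on the punctured torus over to the complement of the
    ridge. *)
Lemma core_sub_ridge (x : R * R * R) : cdist c x = 0 -> ridge Omega x.
Proof.
move=> xc0.
have x0 : 0 < axdist x by apply: axdist_gt0; rewrite xc0 ltW.
have ab : (1 : R) ^+ 2 + 0 ^+ 2 = 1 by rewrite expr1n expr0n addr0.
have xax : axdist x = c.
  by apply/eqP; rewrite -subr_eq0 -normr_le0 -xc0; exact: axdist_cdist.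
have x2 : x.2 = 0.
  have : Num.sqrt (x.2 ^+ 2) <= cdist c x by rewrite ler_wsqrtr// lerDr sqr_ge0.
  by rewrite xc0 sqrtr_sqr normr_le0 => /eqP.
have xE : x = core_ray c x 1 0 0.
  rewrite /core_ray !mul0r addr0 xax divff ?gt_eqF ?mul1r//; last by rewrite -xax.
  by case: x x2 {xc0 x0 xax} => -[? ?] ? /= ->.
have Ox : Omega x by rewrite /Omega solid_torusE//= xc0.
pose y := core_ray c x 1 0 r.
have segE t : y + t *: (x - y) = core_ray c x 1 0 (r * (1 - t)).
  have scE (u v : R) : u *: (v : R^o) = u * v by [].
  by rewrite {1}xE /y /core_ray; congr (_, _, _) => /=; rewrite scE; ring.
have fr s : `|s| = r -> frontier Omega (core_ray c x 1 0 s).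
  move=> sr; rewrite frontier_solid_torus /= cdist_core_ray//.
  by rewrite mulr1; have := r_ltc; have := lerNnormlW (lexx `|s|); rewrite sr; lra.
pose T := [set t : R | 0 < t /\ near_points Omega (y + t *: (x - y)) y].
have npx : near_points Omega x y.
  split; first by apply: fr; rewrite gtr0_norm.
  rewrite bdist_solid_torus// xc0 subr0 {1}xE enorm_core_ray//.
  by rewrite sub0r normrN gtr0_norm.
have T1 : T 1 by split=> //; rewrite scale1r addrC subrK.
have Tle t : T t -> t <= 1.
  move=> [t0 [_ yt]]; rewrite leNgt; apply/negP => t1.
  (* The competitor is the antipodal point at signed distance [- r]: its distance is r |2 - t|,
     against r t for [y], and |2 - t| < t as soon as t > 1. *)
  have bd : bdist Omega (y + t *: (x - y)) <= `|r * (1 - t) - - r|.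
    rewrite -(enorm_core_ray c _ _ x0 ab) -segE; apply: ge_inf.
      by exists 0 => _ [z _ <-]; exact: sqrtr_ge0.
    by exists (core_ray c x 1 0 (- r)) => //; apply: fr; rewrite normrN gtr0_norm.
  move: bd; rewrite -yt segE enorm_core_ray//.
  have rt : 0 < r * (t - 1) by apply: mulr_gt0 => //; lra.
  rewrite [X in X <= _]distrC gtr0_norm; last by have := r_gt0; lra.
  by apply/negP; rewrite -ltNge ltr_norml; have := r_gt0; move=> r0; apply/andP; split; lra.
exists x, y; split=> //; first by exists 1.
have -> : sup T = 1.
  apply/eqP; rewrite eq_le; apply/andP; split.
    exact: (ge_sup (ex_intro _ _ T1) Tle).
  exact: (ub_le_sup (ex_intro _ _ Tle) T1).
by rewrite scale1r addrC subrK.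
Qed.

End torus_geometry.

(** * Derivatives of the distance function *)

Section pointwise_calculus.
Context (R : realType).

Lemma for_continuousD (T : topologicalType) (f g : T -> R) (x : T) :
  {for x, continuous f} -> {for x, continuous g} ->
  {for x, continuous (fun y => f y + g y)}.
Proof. by move=> cf cg; exact: (cvgD cf cg). Qed.

Lemma for_continuousB (T : topologicalType) (f g : T -> R) (x : T) :
  {for x, continuous f} -> {for x, continuous g} ->
  {for x, continuous (fun y => f y - g y)}.
Proof. by move=> cf cg; exact: (cvgB cf cg). Qed.

Lemma for_continuousM (T : topologicalType) (f g : T -> R) (x : T) :
  {for x, continuous f} -> {for x, continuous g} ->
  {for x, continuous (fun y => f y * g y)}.
Proof. by move=> cf cg; exact: (cvgM cf cg). Qed.

Lemma for_continuousV (T : topologicalType) (f : T -> R) (x : T) :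
  f x != 0 -> {for x, continuous f} -> {for x, continuous (fun y => (f y)^-1)}.
Proof. by move=> fx cf; exact: (cvgV fx cf). Qed.

Lemma for_continuous_cst (T : topologicalType) (a : R) (x : T) :
  {for x, continuous (fun=> a)}.
Proof. exact: cvg_cst. Qed.

Lemma for_continuous_sum (T : topologicalType) (n : nat) (g : 'I_n -> T -> R)
    (x : T) :
  (forall i, {for x, continuous (g i)}) ->
  {for x, continuous (fun y => \sum_(i < n) g i y)}.
Proof.
elim: n g => [|n ih] g cg.
  under [X in {for x, continuous X}]funext do rewrite big_ord0.
  exact: for_continuous_cst.
under [X in {for x, continuous X}]funext do rewrite big_ord_recl.
by apply: for_continuousD; [exact: cg|apply: ih => i; exact: cg].
Qed.

Lemma is_derive_mul (V : normedModType R) (f g : V -> R) (x v : V) (df dg : R) :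
  is_derive x v f df -> is_derive x v g dg ->
  is_derive x v (fun y => f y * g y) (f x * dg + g x * df).
Proof. by move=> hf hg; exact: (is_deriveM hf hg). Qed.

Lemma is_derive_add (V : normedModType R) (f g : V -> R) (x v : V) (df dg : R) :
  is_derive x v f df -> is_derive x v g dg ->
  is_derive x v (fun y => f y + g y) (df + dg).
Proof. by move=> hf hg; exact: (is_deriveD hf hg). Qed.

Lemma is_derive_sub (V : normedModType R) (f g : V -> R) (x v : V) (df dg : R) :
  is_derive x v f df -> is_derive x v g dg ->
  is_derive x v (fun y => f y - g y) (df - dg).
Proof. by move=> hf hg; exact: (is_deriveB hf hg). Qed.

Lemma is_derive_inv (V : normedModType R) (f : V -> R) (x v : V) (df : R) :
  f x != 0 -> is_derive x v f df ->
  is_derive x v (fun y => (f y)^-1) (- (f x) ^- 2 * df).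
Proof.
move=> fx hf.
have h : is_derive (f x) 1 GRing.inv (- (f x) ^- 2).
  apply: (is_derive_eq (@is_deriveV R id (f x) 1 1 fx (is_derive_id (f x) 1))).
  by rewrite [_ *: _]mulr1.
exact: (is_derive_chain h hf).
Qed.

End pointwise_calculus.

Section core_distance_derivatives.
Context (R : realType) (c : R).
Implicit Types x : R * R * R.

Lemma is_derive_coord1 x (v : R * R * R) :
  is_derive x v (fun y => y.1.1) v.1.1.
Proof.
apply: (@is_derive_transport _ _ _ (fun t : R => t * v.1.1 + x.1.1) _ 0 1) => [h|].
  by rewrite addr0 [h *: 1]mulr1.
apply: is_derive_eq; rewrite addr0 scaler0 add0r [_ *: _]mulr1.
by [].
Qed.

Lemma is_derive_coord2 x (v : R * R * R) :
  is_derive x v (fun y => y.1.2) v.1.2.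
Proof.
apply: (@is_derive_transport _ _ _ (fun t : R => t * v.1.2 + x.1.2) _ 0 1) => [h|].
  by rewrite addr0 [h *: 1]mulr1.
apply: is_derive_eq; rewrite addr0 scaler0 add0r [_ *: _]mulr1.
by [].
Qed.

Lemma is_derive_coord3 x (v : R * R * R) : is_derive x v (fun y => y.2) v.2.
Proof.
apply: (@is_derive_transport _ _ _ (fun t : R => t * v.2 + x.2) _ 0 1) => [h|].
  by rewrite addr0 [h *: 1]mulr1.
apply: is_derive_eq; rewrite addr0 scaler0 add0r [_ *: _]mulr1.
by [].
Qed.

Lemma is_derive_axdist x (v : R * R * R) : 0 < axdist x ->
  is_derive x v (@axdist R) ((x.1.1 * v.1.1 + x.1.2 * v.1.2) / axdist x).
Proof.
move=> x0; have h1 := is_derive_coord1 x v; have h2 := is_derive_coord2 x v.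
have s0 : 0 < x.1.1 ^+ 2 + x.1.2 ^+ 2 by rewrite -sqrtr_gt0.
apply: (is_derive_eq (@is_derive_chain _ _ _
  (fun y : R * R * R => y.1.1 ^+ 2 + y.1.2 ^+ 2) x v _ _ (is_derive1_sqrt s0)
  (is_derive_add (is_derive_mul h1 h1) (is_derive_mul h2 h2)))); rewrite -/(axdist x) /GRing.scale/=.
by field; rewrite gt_eqF.
Qed.

Lemma is_derive_cdist x (v : R * R * R) : 0 < axdist x -> 0 < cdist c x ->
  is_derive x v (cdist c)
    (((axdist x - c) * ((x.1.1 * v.1.1 + x.1.2 * v.1.2) / axdist x) +
      x.2 * v.2) / cdist c x).
Proof.
move=> x0 d0; have h1 := is_derive_axdist v x0; have h3 := is_derive_coord3 x v.
have s0 : 0 < (axdist x - c) ^+ 2 + x.2 ^+ 2 by rewrite -sqrtr_gt0.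
have h2 := is_derive_sub h1 (is_derive_cst c x v).
apply: (is_derive_eq (@is_derive_chain _ _ _
  (fun y : R * R * R => (axdist y - c) ^+ 2 + y.2 ^+ 2) x v _ _
  (is_derive1_sqrt s0)
  (is_derive_add (is_derive_mul h2 h2) (is_derive_mul h3 h3)))); rewrite -/(cdist c x) /GRing.scale/=.
by field; rewrite !gt_eqF.
Qed.

(* [dcdist i] and [ddcdist i] are the first and second derivatives of [cdist c]
   in the [i]-th coordinate, away from the axis and from the core circle. *)
Definition dcdist (i : 'I_3) x : R :=
  match val i with
  | 0%N => (1 - c / axdist x) * x.1.1 / cdist c x
  | 1%N => (1 - c / axdist x) * x.1.2 / cdist c x
  | _ => x.2 / cdist c x
  end.

Definition ddcdist (i : 'I_3) x : R :=
  (match val i with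
   | 0%N => 1 - c / axdist x + c * x.1.1 ^+ 2 / axdist x ^+ 3
   | 1%N => 1 - c / axdist x + c * x.1.2 ^+ 2 / axdist x ^+ 3
   | _ => 1
   end - dcdist i x ^+ 2) / cdist c x.

Lemma is_derive_cdist_basis (i : 'I_3) x : 0 < axdist x -> 0 < cdist c x ->
  is_derive x (basis3 R i) (cdist c) (dcdist i x).
Proof.
move=> x0 d0; apply: (is_derive_eq (is_derive_cdist (basis3 R i) x0 d0)).
rewrite /dcdist; case: i => -[|[|[|//]]] i3 /=; field; rewrite !gt_eqF//.
Qed.

(** The product of [cdist c] and [dcdist i] is the numerator in [dcdist], whose derivative is the
    first term of [ddcdist]. The product rule subtracts [dcdist i x ^+ 2] and leaves the division by
    [cdist c x]. *)
Lemma is_derive_dcdist (i : 'I_3) x : 0 < axdist x -> 0 < cdist c x ->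
  is_derive x (basis3 R i) (dcdist i) (ddcdist i x).
Proof.
move=> x0 d0; have h1 := is_derive_axdist (basis3 R i) x0.
have h2 := is_derive_cdist_basis i x0 d0.
have x00 : axdist x != 0 by rewrite gt_eqF.
have d00 : cdist c x != 0 by rewrite gt_eqF.
have h3 := is_derive_inv x00 h1.
have h4 := is_derive_inv d00 h2.
have hc : is_derive x (basis3 R i) (fun=> c) 0 by exact: is_derive_cst.
have h1c : is_derive x (basis3 R i) (fun=> 1 : R) 0 by exact: is_derive_cst.
have h5 := is_derive_sub h1c (is_derive_mul hc h3).
have k1 := is_derive_coord1 x (basis3 R i).
have k2 := is_derive_coord2 x (basis3 R i).
have k3 := is_derive_coord3 x (basis3 R i).
have h6 := is_derive_mul (is_derive_mul h5 k1) h4.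
have h7 := is_derive_mul (is_derive_mul h5 k2) h4.
have h8 := is_derive_mul k3 h4.
case: i h1 h2 h3 h4 hc h1c h5 k1 k2 k3 h6 h7 h8 => -[|[|[|//]]] i3 h1 h2 h3 h4 hc h1c h5 k1 k2 k3 h6 h7 h8.
- apply: (is_derive_eq h6); rewrite /ddcdist/= /dcdist/= /GRing.scale/=.
  by field; rewrite x00 d00.
- apply: (is_derive_eq h7); rewrite /ddcdist/= /dcdist/= /GRing.scale/=.
  by field; rewrite x00 d00.
- apply: (is_derive_eq h8); rewrite /ddcdist/= /dcdist/= /GRing.scale/=.
  by field; rewrite d00.
Qed.

(** The eikonal equation. Once the definitions of the two distances are used to eliminate
    [x.1.1 ^+ 2] and [x.2 ^+ 2], what remains is a rational identity. *)
Lemma sum_dcdist_sqr x : 0 < axdist x -> 0 < cdist c x ->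
  \sum_(i < 3) dcdist i x ^+ 2 = 1.
Proof.
move=> x0 d0; rewrite !big_ord_recl big_ord0 /dcdist/= addr0.
have x00 : axdist x != 0 by rewrite gt_eqF.
have d00 : cdist c x != 0 by rewrite gt_eqF.
have e1 : x.1.1 ^+ 2 = axdist x ^+ 2 - x.1.2 ^+ 2 by rewrite sqr_sqrtD addrK.
have e2 : x.2 ^+ 2 = cdist c x ^+ 2 - (axdist x - c) ^+ 2.
  by rewrite sqr_sqrtD; ring.
rewrite !exprMn e1 e2; field; rewrite x00 d00//.
Qed.

(** Over the three coordinates the first terms add up to 3 - 2c/rho + c/rho, and by the eikonal
    equation the subtracted squares add up to 1. *)
Lemma sum_ddcdist x : 0 < axdist x -> 0 < cdist c x ->
  \sum_(i < 3) ddcdist i x = (2 - c / axdist x) / cdist c x.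
Proof.
move=> x0 d0; have := sum_dcdist_sqr x0 d0.
rewrite /ddcdist -mulr_suml sumrB => ->.
have x00 : axdist x != 0 by rewrite gt_eqF.
have e1 : x.1.1 ^+ 2 = axdist x ^+ 2 - x.1.2 ^+ 2 by rewrite sqr_sqrtD addrK.
rewrite !big_ord_recl big_ord0 /= addr0; congr (_ / _).
by rewrite e1; field; rewrite x00.
Qed.

Lemma continuous_coord1 : continuous (fun x => x.1.1).
Proof. by move=> x; apply: (@continuous_comp _ _ _ fst fst); exact: cvg_fst. Qed.

Lemma continuous_coord2 : continuous (fun x => x.1.2).
Proof.
by move=> x; apply: (@continuous_comp _ _ _ fst snd); [exact: cvg_fst|exact: cvg_snd].
Qed.

Lemma continuous_dcdist (i : 'I_3) x : 0 < axdist x -> 0 < cdist c x ->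
  {for x, continuous (dcdist i)}.
Proof.
move=> x0 d0; have h1 := @continuous_coord1 x; have h2 := @continuous_coord2 x.
have h3 : {for x, continuous (fun x => x.2)} by exact: cvg_snd.
have kc t : {for x, continuous (fun=> t : R)} by exact: for_continuous_cst.
have k1 : {for x, continuous (fun y => (axdist y)^-1)}.
  exact: (for_continuousV (lt0r_neq0 x0) (@continuous_axdist R x)).
have k2 : {for x, continuous (fun y => (cdist c y)^-1)}.
  exact: (for_continuousV (lt0r_neq0 d0) (@continuous_cdist R c x)).
have k3 := for_continuousB (kc 1) (for_continuousM (kc c) k1).
rewrite /dcdist; case: i => -[|[|[|//]]] i3 /=.
- exact: (for_continuousM (for_continuousM k3 h1) k2).
- exact: (for_continuousM (for_continuousM k3 h2) k2).
- exact: (for_continuousM h3 k2).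
Qed.

Lemma continuous_ddcdist (i : 'I_3) x : 0 < axdist x -> 0 < cdist c x ->
  {for x, continuous (ddcdist i)}.
Proof.
move=> x0 d0; have h1 := @continuous_coord1 x; have h2 := @continuous_coord2 x.
have kc t : {for x, continuous (fun=> t : R)} by exact: for_continuous_cst.
have k0 := @continuous_axdist R x.
have k1 : {for x, continuous (fun y => (axdist y)^-1)}.
  exact: (for_continuousV (lt0r_neq0 x0) k0).
have k2 : {for x, continuous (fun y => (cdist c y)^-1)}.
  exact: (for_continuousV (lt0r_neq0 d0) (@continuous_cdist R c x)).
have k3 := for_continuousB (kc 1) (for_continuousM (kc c) k1).
have k4 := for_continuousM (@continuous_dcdist i x x0 d0) (@continuous_dcdist i x x0 d0).
have x30 : axdist x ^+ 3 != 0 by rewrite expf_neq0// gt_eqF.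
have k5 : {for x, continuous (fun y => (axdist y ^+ 3)^-1)}.
  exact: (@for_continuousV _ _ (fun y => axdist y ^+ 3) x x30 (for_continuousM k0 (for_continuousM k0 k0))).
have l1 := for_continuousD k3 (for_continuousM (for_continuousM (kc c) (for_continuousM h1 h1)) k5).
have l2 := for_continuousD k3 (for_continuousM (for_continuousM (kc c) (for_continuousM h2 h2)) k5).
rewrite /ddcdist; case: i k4 => -[|[|[|//]]] i3 /= k4.
- exact: (for_continuousM (for_continuousB l1 k4) k2).
- exact: (for_continuousM (for_continuousB l2 k4) k2).
- exact: (for_continuousM (for_continuousB (kc 1) k4) k2).
Qed.

End core_distance_derivatives.

(** * The boundary distance away from the core circle *)

Section torus_distance.
Context (R : realType) (r c : R) (r_gt0 : 0 < r) (r_ltc : 2 * r < c).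
Let Omega := solid_torus r c.
Implicit Types x : R * R * R.

(** The torus without its core circle, where [cdist] has a conical singularity; here the boundary
    distance has explicit first and second derivatives. *)
Definition punctured_torus (r c : R) : set (R * R * R) :=
  [set x | 0 < cdist c x /\ cdist c x < r].
Let U := punctured_torus r c.

Let rc : r < c.
Proof. by have := r_gt0; have := r_ltc; lra. Qed.

Lemma punctured_torus_open : open U.
Proof.
have -> : U = cdist c @^-1` ([set t | 0 < t] `&` [set t | t < r]) by [].
apply: open_comp; first by move=> x _; exact: continuous_cdist.
by apply: openI; [exact: open_gt|exact: open_lt].
Qed.

Lemma punctured_torus_sub x : U x -> Omega x.
Proof. by move=> [_ xr]; rewrite /Omega solid_torusE. Qed.

Lemma setD_ridge_sub x : (Omega `\` ridge Omega) x -> U x.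
Proof.
move=> [Ox nx]; split; last by move: Ox; rewrite /Omega solid_torusE.
rewrite lt_neqAle cdist_ge0 andbT eq_sym; apply/eqP => x0; apply: nx.
exact: core_sub_ridge.
Qed.

Lemma axdist_gt0_punctured x : U x -> 0 < axdist x.
Proof. by move=> [_ xr]; apply: (axdist_gt0 rc); exact: ltW. Qed.

Lemma bdist_punctured x : U x -> bdist Omega x = r - cdist c x.
Proof. by move=> /punctured_torus_sub Ox; rewrite (bdist_solid_torus r_gt0 rc). Qed.

Lemma is_derive_bdist (i : 'I_3) x : U x ->
  is_derive x (basis3 R i) (bdist Omega) (- dcdist c i x).
Proof.
move=> Ux; have x0 := axdist_gt0_punctured Ux; have [d0 dr] := Ux.
have h : is_derive x (basis3 R i) (fun y => r - cdist c y) (- dcdist c i x).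
  have hr : is_derive x (basis3 R i) (fun=> r) 0 by exact: is_derive_cst.
  apply: (is_derive_eq (is_derive_sub hr (is_derive_cdist_basis i x0 d0))).
  by rewrite sub0r.
apply: (near_eq_is_derive _ h).
have : \forall y \near x, U y by exact: (open_nbhs_nbhs (conj punctured_torus_open Ux)).
by apply: filterS => y Uy; rewrite bdist_punctured.
Qed.

Lemma partial_bdist (i : 'I_3) x : U x ->
  partial i (bdist Omega) x = - dcdist c i x.
Proof. by move=> Ux; have [] := is_derive_bdist i Ux. Qed.

Lemma is_derive_partial_bdist (i : 'I_3) x : U x ->
  is_derive x (basis3 R i) (partial i (bdist Omega)) (- ddcdist c i x).
Proof.
move=> Ux; have x0 := axdist_gt0_punctured Ux; have [d0 dr] := Ux.
have h : is_derive x (basis3 R i) (fun y => 0 - dcdist c i y) (- ddcdist c i x).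
  have hr : is_derive x (basis3 R i) (fun=> 0 : R) 0 by exact: is_derive_cst.
  apply: (is_derive_eq (is_derive_sub hr (is_derive_dcdist i x0 d0))).
  by rewrite sub0r.
apply: (near_eq_is_derive _ h).
have : \forall y \near x, U y by exact: (open_nbhs_nbhs (conj punctured_torus_open Ux)).
by apply: filterS => y Uy; rewrite partial_bdist// sub0r.
Qed.

Lemma has_laplacian_bdist x : U x -> has_laplacian (bdist Omega) x.
Proof.
move=> Ux i; split; last by have [] := is_derive_partial_bdist i Ux.
have : \forall y \near x, U y by exact: (open_nbhs_nbhs (conj punctured_torus_open Ux)).
by apply: filterS => y Uy; have [] := is_derive_bdist i Uy.
Qed.

Lemma laplacian_bdist x : U x ->
  laplacian (bdist Omega) x = - ((2 - c / axdist x) / cdist c x).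
Proof.
move=> Ux; have x0 := axdist_gt0_punctured Ux; have [d0 dr] := Ux.
rewrite -(sum_ddcdist x0 d0) -sumrN; apply: eq_bigr => i _.
by have [] := is_derive_partial_bdist i Ux.
Qed.

(** Everything follows from rho >= c - d together with d < r < c/2. This is where the ring condition
    [2 * r < c] takes effect: it yields both the sign of the Laplacian and that of the curvature
    factor. *)
Lemma axdist_bounds x : U x ->
  [/\ c - cdist c x <= axdist x, cdist c x < axdist x & c < 2 * axdist x].
Proof.
move=> [d0 dr]; have := axdist_cdist c x; have := r_ltc; rewrite ler_norml.
by move=> ? /andP[? ?]; split; lra.
Qed.

Lemma laplacian_bdist_lt0 x : U x -> laplacian (bdist Omega) x < 0.
Proof.
move=> Ux; rewrite laplacian_bdist// oppr_lt0.
have x0 := axdist_gt0_punctured Ux; have [_ _ xc] := axdist_bounds Ux.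
by apply: divr_gt0; [rewrite subr_gt0 ltr_pdivrMr|case: Ux].
Qed.

Lemma curvature_factor_gt0 x : U x -> 0 < (cdist c x)^-1 - (axdist x)^-1.
Proof.
move=> Ux; have x0 := axdist_gt0_punctured Ux; have [_ dx _] := axdist_bounds Ux.
by rewrite subr_gt0 ltf_pV2 ?posrE//; case: Ux.
Qed.

(** Passes from the exact value of - Laplacian delta to the factor in the theorem. The gap is a
    positive multiple of rho - (c - d), which is zero precisely on the segments from the core
    straight towards the axis. *)
Lemma curvature_factor_le x : U x ->
  (cdist c x)^-1 - (axdist x)^-1 <= (2 - c / axdist x) / cdist c x.
Proof.
move=> Ux; have x0 := axdist_gt0_punctured Ux; have [d0 dr] := Ux.
have [xc _ _] := axdist_bounds Ux.
rewrite -subr_ge0.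
have -> : (2 - c / axdist x) / cdist c x - ((cdist c x)^-1 - (axdist x)^-1) =
    (axdist x - c + cdist c x) / (axdist x * cdist c x).
  by field; rewrite !gt_eqF.
by apply: divr_ge0; [lra|rewrite mulr_ge0 ?axdist_ge0 ?cdist_ge0].
Qed.

Lemma dot_grad_bdist (f : R * R * R -> R) x : U x ->
  dot (grad (bdist Omega) x) (grad f x) =
  - \sum_(i < 3) dcdist c i x * partial i f x.
Proof.
move=> Ux; rewrite /dot/= !partial_bdist// !big_ord_recl big_ord0 addr0.
have -> : lift ord0 (lift ord0 ord0) = 2 :> 'I_3 by exact: val_inj.
have -> : lift ord0 ord0 = 1 :> 'I_3 by exact: val_inj.
by rewrite !mulNr !opprD addrA.
Qed.

End torus_distance.

(** Young's inequality with exponents p and p/(p-1) for [b] and (k a)^(p-1), where k = (p-1)/p,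
    multiplied by p. *)
Lemma powR_young (R : realType) (p a b : R) : 1 < p -> 0 <= a -> 0 <= b ->
  p * (((p - 1) / p) `^ (p - 1) * a `^ (p - 1)) * b <=
  b `^ p + (p - 1) * (((p - 1) / p) `^ p * a `^ p).
Proof.
move=> p1 a0 b0; have p0 : 0 < p by lra.
have k0 : 0 <= (p - 1) / p by apply: divr_ge0; lra.
rewrite -!powRM//; set v := _ * a.
have v0 : 0 <= v by exact: mulr_ge0.
have q0 : 0 < p / (p - 1) by apply: divr_gt0; lra.
have pq : p^-1 + (p / (p - 1))^-1 = 1 by field; rewrite !gt_eqF//; lra.
have := conjugate_powR b0 (powR_ge0 v (p - 1)) p0 q0 pq.
rewrite -powRrM; have -> : (p - 1) * (p / (p - 1)) = p by field; rewrite gt_eqF//; lra.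
rewrite -(ler_pM2l p0).
have -> : p * (b `^ p / p + v `^ p / (p / (p - 1))) = b `^ p + (p - 1) * v `^ p.
  by field; rewrite !gt_eqF//; lra.
by rewrite mulrA [_ * b]mulrAC.
Qed.

(** * The Hardy inequality *)

Section weights.
Context (R : realType) (p r e : R).

(** For t > 0 it vanishes up to t = e, is nondecreasing in t, and increases to 1 as e decreases to
    0. At t = 0 the convention e/0 = 0 gives the value 1, not 0. *)
Definition cutoff (t : R) : R := Num.max (1 - e / t) 0 ^+ 2.

Definition dcutoff (t : R) : R := 2 * Num.max (1 - e / t) 0 * (e / t ^+ 2).

(** At t = d this is the coefficient eta(d) delta^(1-p) of grad d in the vector field. *)
Definition weight (t : R) : R := cutoff t * (r - t) `^ (1 - p).

Definition dweight (t : R) : R :=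
  dcutoff t * (r - t) `^ (1 - p) + cutoff t * ((p - 1) * (r - t) `^ (- p)).

Lemma is_derive_cutoff (t : R) : t != 0 -> is_derive t 1 cutoff (dcutoff t).
Proof.
move=> t0.
have h1 : is_derive t (1 : R) (fun=> 1 : R) 0 by exact: is_derive_cst.
have he : is_derive t (1 : R) (fun=> e) 0 by exact: is_derive_cst.
have hV := is_derive_inv t0 (is_derive_id t (1 : R)).
have h := is_derive_sub h1 (is_derive_mul he hV).
apply: (is_derive_eq (@is_derive1_comp R (fun s => Num.max s 0 ^+ 2)
  (fun s => 1 - e / s) t _ _ (is_derive_sqr_pos (1 - e / t)) h)).
by rewrite /dcutoff; field.
Qed.

Lemma is_derive_rpowR (a t : R) : t < r ->
  is_derive t 1 (fun s => (r - s) `^ a) (- (a * (r - t) `^ (a - 1))).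
Proof.
move=> tr; have rt : 0 < r - t by rewrite subr_gt0.
have h1 : is_derive t (1 : R) (fun=> r) 0 by exact: is_derive_cst.
have h := is_derive_sub h1 (is_derive_id t (1 : R)).
apply: (is_derive_eq (@is_derive1_comp R (@powR R ^~ a) (fun s => r - s) t _ _
  (is_derive1_powR a rt) h)).
by ring.
Qed.

Lemma is_derive_weight (t : R) : t != 0 -> t < r ->
  is_derive t 1 weight (dweight t).
Proof.
move=> t0 tr.
apply: (is_derive_eq (is_derive_mul (is_derive_cutoff t0) (is_derive_rpowR (1 - p) tr))).
have -> : 1 - p - 1 = - p by ring.
by rewrite /dweight; ring.
Qed.

Lemma is_derive_for_continuous (f : R -> R) (t df : R) :
  is_derive t 1 f df -> {for t, continuous f}.
Proof.
by move=> [fd _]; apply: differentiable_continuous; exact/derivable1_diffP.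
Qed.

Lemma continuous_dcutoff (t : R) : t != 0 -> {for t, continuous dcutoff}.
Proof.
move=> t0.
have hV : {for t, continuous (fun s : R => s^-1)}.
  by apply: for_continuousV => //; exact: cvg_id.
have h1 : {for t, continuous (fun s : R => 1 - e / s)}.
  by apply: for_continuousB; [|apply: for_continuousM => //]; exact: for_continuous_cst.
(* Writing twice the positive part as u + |u| reduces continuity to that of the absolute value. *)
have -> : dcutoff = (fun s => (1 - e / s + `|1 - e / s|) * (e / s ^+ 2)).
  apply/funext => s; rewrite /dcutoff maxr_absE subr0 addr0.
  by rewrite [2 * _]mulrC divfK// pnatr_eq0.
apply: for_continuousM.
  apply: for_continuousD => //.
  by apply: (@continuous_comp _ _ _ (fun s : R => 1 - e / s) Num.norm) => //; exact: norm_continuous.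
apply: for_continuousM; first exact: for_continuous_cst.
apply: (@for_continuousV _ _ (fun s : R => s ^+ 2)); first exact: expf_neq0.
exact: exprn_continuous.
Qed.

Lemma continuous_dweight (t : R) : t != 0 -> t < r -> {for t, continuous dweight}.
Proof.
move=> t0 tr.
have h a := is_derive_for_continuous (is_derive_rpowR a tr).
apply: for_continuousD; first by apply: for_continuousM; [exact: continuous_dcutoff|exact: h].
apply: for_continuousM; first exact: is_derive_for_continuous (is_derive_cutoff t0).
by apply: for_continuousM; [exact: for_continuous_cst|exact: h].
Qed.

Lemma cutoff_ge0 (t : R) : 0 <= cutoff t.
Proof. exact: sqr_ge0. Qed.

Lemma cutoff_le1 (t : R) : 0 <= e -> 0 <= t -> cutoff t <= 1.
Proof.
move=> e0 t0; rewrite /cutoff exprn_ile1// ?le_max ?lexx ?orbT//.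
by rewrite ge_max ler01 andbT lerBlDr lerDl divr_ge0.
Qed.

Lemma dcutoff_ge0 (t : R) : 0 <= e -> 0 <= dcutoff t.
Proof.
move=> e0; rewrite /dcutoff; apply: mulr_ge0; last by rewrite divr_ge0// sqr_ge0.
by rewrite mulr_ge0// le_max lexx orbT.
Qed.

Lemma max_cutoff_eq0 (t : R) : 0 < t -> t < e -> Num.max (1 - e / t) 0 = 0.
Proof.
by move=> t0 te; rewrite max_r// subr_le0 ler_pdivlMr// mul1r ltW.
Qed.

Lemma weight_eq0 (t : R) : 0 < t -> t < e -> weight t = 0.
Proof. by move=> t0 te; rewrite /weight /cutoff max_cutoff_eq0// expr0n mul0r. Qed.

Lemma dweight_eq0 (t : R) : 0 < t -> t < e -> dweight t = 0.
Proof.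
move=> t0 te.
by rewrite /dweight /dcutoff /cutoff max_cutoff_eq0// expr0n mulr0 !mul0r addr0.
Qed.

End weights.

(** * The flux and the vanishing integral of its divergence *)

Section flux.
Context (R : realType) (r c : R) (r_gt0 : 0 < r) (r_ltc : 2 * r < c).
Context (p e : R) (p_gt1 : 1 < p) (e_gt0 : 0 < e) (f : R * R * R -> R).
Let Omega := solid_torus r c.
Hypothesis f_test : test_function Omega f.
Implicit Types x : R * R * R.

(* The derivative in the [i]-th coordinate of
   [|f|^p * weight p r e (cdist c x) * dcdist c i x]. *)
Definition flux_deriv (i : 'I_3) x : R :=
  `|f x| `^ p * (weight p r e (cdist c x) * ddcdist c i x +
    dcdist c i x * (dweight p r e (cdist c x) * dcdist c i x)) +
  weight p r e (cdist c x) * dcdist c i x *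
    (dnorm_powR p (f x) * partial i f x).

Definition flux_div x : R := \sum_(i < 3) flux_deriv i x.

(** Outside this compact set the flux and its derivatives are zero. Inside, [e <= cdist c x] keeps
    away from the core circle and the support of [f] keeps away from the boundary, so all factors
    are regular. *)
Let K : set (R * R * R) :=
  closure [set x | f x != 0] `&` [set x | e <= cdist c x].

Let K_sub x : K x -> punctured_torus r c x.
Proof.
case: f_test => _ _ fO [clx ex]; split; first exact: lt_le_trans ex.
have := fO _ clx; rewrite /Omega solid_torusE//.
by have := r_gt0; have := r_ltc; lra.
Qed.

Let K_compact : compact K.
Proof.
case: f_test => _ cf _; apply: compact_closedI => //.
have -> : [set x : R * R * R | e <= cdist c x] = cdist c @^-1` [set t | e <= t] by [].
by apply: closed_comp; [move=> y _; exact: continuous_cdist|exact: closed_ge].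
Qed.

Let off_K x : ~ K x ->
  f x = 0 \/ forall i, dcdist c i x = 0 /\ ddcdist c i x = 0 \/
    weight p r e (cdist c x) = 0 /\ dweight p r e (cdist c x) = 0.
Proof.
move=> nKx; have [->|fx] := eqVneq (f x) 0; first by left.
right=> i; have [d0|d0] := eqVneq (cdist c x) 0.
  (* On the core circle itself the cutoff is not 0, since e/0 = 0. The flux vanishes there for
     another reason: [dcdist] and [ddcdist] are quotients by [cdist c x = 0]. *)
  left; rewrite /ddcdist /dcdist d0 invr0 !mulr0; split=> //.
  by case: i => -[|[|[|//]]].
have dgt0 : 0 < cdist c x by rewrite lt_def d0 cdist_ge0.
have de : cdist c x < e.
  rewrite ltNge; apply/negP => ed; apply: nKx; split => //.
  exact: subset_closure.
by right; rewrite weight_eq0 ?dweight_eq0.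
Qed.

Lemma test_derivable (i : 'I_3) x : is_derive x (basis3 R i) f (partial i f x).
Proof.
by case: f_test => /(_ 1%N) [_ fd _] _ _; apply: derivableP; exact: fd.
Qed.

Lemma test_continuous : continuous f.
Proof. by case: f_test => /(_ 0%N). Qed.

Lemma test_continuous_partial (i : 'I_3) : continuous (partial i f).
Proof. by case: f_test => /(_ 1%N) [_ _ /(_ i)]. Qed.

Lemma continuous_norm_powR_test x : {for x, continuous (fun y => `|f y| `^ p)}.
Proof.
apply: (@continuous_comp _ _ _ f (fun t : R => `|t| `^ p)); first exact: test_continuous.
by apply: continuous_norm_powR; have := p_gt1; lra.
Qed.

Lemma flux_deriv_integral (i : 'I_3) :
  (lebesgue3 R).-integrable setT (EFin \o flux_deriv i) /\
  (\int[lebesgue3 R]_x (flux_deriv i x)%:E = 0)%E.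
Proof.
pose G x := `|f x| `^ p * (weight p r e (cdist c x) * dcdist c i x).
apply: (@integral_partial_local _ i K G) => //.
- move=> x /K_sub Ux; have x0 := axdist_gt0_punctured r_gt0 r_ltc Ux.
  have [d0 dr] := Ux; have d00 := lt0r_neq0 d0.
  apply: is_derive_mul.
    exact: (is_derive_chain (is_derive_norm_powR (f x) p_gt1) (test_derivable i x)).
  apply: is_derive_mul; last exact: is_derive_dcdist.
  exact: (@is_derive_chain _ _ (weight p r e) (cdist c) x _ _ _
    (is_derive_weight p e d00 dr) (is_derive_cdist_basis i x0 d0)).
- move=> x /K_sub Ux; have x0 := axdist_gt0_punctured r_gt0 r_ltc Ux.
  have [d0 dr] := Ux; have d00 := lt0r_neq0 d0.
  have n1 := continuous_dcdist (i := i) x0 d0.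
  have n2 := continuous_ddcdist (i := i) x0 d0.
  have w1 : {for x, continuous (fun y => weight p r e (cdist c y))}.
    apply: (@continuous_comp _ _ _ (cdist c)); first exact: continuous_cdist.
    exact: (is_derive_for_continuous (is_derive_weight p e d00 dr)).
  have w2 : {for x, continuous (fun y => dweight p r e (cdist c y))}.
    apply: (@continuous_comp _ _ _ (cdist c)); first exact: continuous_cdist.
    exact: continuous_dweight.
  have f1 := @continuous_norm_powR_test x.
  have f2 : {for x, continuous (fun y => dnorm_powR p (f y))}.
    apply: (@continuous_comp _ _ _ f); first exact: test_continuous.
    exact: continuous_dnorm_powR.
  apply: for_continuousD.
    apply: for_continuousM => //; apply: for_continuousD; first exact: for_continuousM.
    by apply: for_continuousM => //; exact: for_continuousM.
  apply: for_continuousM; first exact: for_continuousM.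
  by apply: for_continuousM => //; exact: test_continuous_partial.
- move=> x nKx; rewrite /G /flux_deriv.
  have p0 : p != 0 by rewrite gt_eqF//; have := p_gt1; lra.
  have [->|/(_ i)[[-> ->]|[-> ->]]] := off_K nKx.
  + rewrite normr0 powR0// !mul0r add0r; split=> //.
    by rewrite /dnorm_powR sgr0 !mul0r !(mul0r, mulr0).
  + by rewrite !(mul0r, mulr0, addr0).
  + by rewrite !(mul0r, mulr0, addr0).
Qed.

Lemma flux_div_integral :
  (lebesgue3 R).-integrable (punctured_torus r c) (EFin \o flux_div) /\
  (\int[lebesgue3 R]_(x in punctured_torus r c) (flux_div x)%:E = 0)%E.
Proof.
have mU : measurable (punctured_torus r c : set (mspace3 R)).
  by apply: open3_measurable; exact: punctured_torus_open.
have [iT eT] := integrable_sum_eq0 flux_deriv_integral.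
apply: integral_restrict_eq0 => // x nUx.
have nKx : ~ K x by move=> /K_sub.
rewrite /flux_div big1// => i _; rewrite /flux_deriv.
have p0 : p != 0 by rewrite gt_eqF//; have := p_gt1; lra.
have [->|/(_ i)[[-> ->]|[-> ->]]] := off_K nKx.
- by rewrite normr0 powR0// /dnorm_powR sgr0 !(mul0r, mulr0, addr0).
- by rewrite !(mul0r, mulr0, addr0).
- by rewrite !(mul0r, mulr0, addr0).
Qed.

End flux.

(** * From the pointwise estimate to the integral inequality *)

Section hardy.
Context (R : realType) (r c : R) (r_gt0 : 0 < r) (r_ltc : 2 * r < c).
Context (p : R) (p_gt1 : 1 < p) (f : R * R * R -> R).
Let Omega := solid_torus r c.
Let U := punctured_torus r c.
Let k := (p - 1) / p.
Hypothesis f_test : test_function Omega f.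
Implicit Types x : R * R * R.

(** The product rule for the divergence of |f|^p w(d) grad d, simplified by |grad d| = 1 and by the
    formula for the Laplacian of d. *)
Lemma flux_divE (e : R) x : U x ->
  flux_div r c p e f x =
  `|f x| `^ p * (weight p r e (cdist c x) * ((2 - c / axdist x) / cdist c x) +
                 dweight p r e (cdist c x)) +
  weight p r e (cdist c x) * dnorm_powR p (f x) *
    \sum_(i < 3) dcdist c i x * partial i f x.
Proof.
move=> Ux; have x0 := axdist_gt0_punctured r_gt0 r_ltc Ux; have [d0 dr] := Ux.
rewrite -(sum_ddcdist x0 d0) -[dweight p r e _]mulr1 -(sum_dcdist_sqr x0 d0).
rewrite !mulr_sumr -big_split/= mulr_sumr -big_split/=.
by apply: eq_bigr => i _; rewrite /flux_deriv; ring.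
Qed.

(** The divergence is bounded below in three moves: the Laplacian of d is replaced by the smaller
    curvature factor, the nonnegative term with the derivative of the cutoff is dropped, and the
    term with grad f, of unknown sign, is replaced by minus its absolute value and absorbed by
    Young's inequality. *)
Lemma hardy_pointwise (e : R) x : 0 < e -> U x ->
  cutoff e (cdist c x) *
    (k `^ p * (`|f x| `^ p / bdist Omega x `^ p) +
     k `^ (p - 1) * (((cdist c x)^-1 - (axdist x)^-1) *
                     (`|f x| `^ p / bdist Omega x `^ (p - 1)))) <=
  k `^ (p - 1) * flux_div r c p e f x +
  `|dot (grad (bdist Omega) x) (grad f x)| `^ p.
Proof.
move=> e0 Ux; have [d0 dr] := Ux.
have p1 := p_gt1; have p0 : 0 < p by lra.
have k0 : 0 < k by rewrite /k divr_gt0//; lra.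
rewrite dot_grad_bdist// normrN flux_divE// bdist_punctured//.
set S := \sum_(i < 3) _; set t := cdist c x; set L := (2 - _) / _.
set M := t^-1 - _.
have ML : M <= L by exact: (curvature_factor_le r_gt0 r_ltc Ux).
have rt : 0 < r - t by rewrite subr_gt0.
set eta := cutoff e t; set a := `|f x| / (r - t).
have eta0 : 0 <= eta by exact: cutoff_ge0.
have eta1 : eta <= 1 by apply: cutoff_le1; exact: ltW.
have a0 : 0 <= a by rewrite divr_ge0// ltW.
have powV s : ((r - t)^-1) `^ s = ((r - t) `^ s)^-1.
  by rewrite -powR_inv1 ?ltW// -powRrM mulN1r powRN.
have aE s : a `^ s = `|f x| `^ s / (r - t) `^ s.
  have ri0 : 0 <= (r - t)^-1 by rewrite invr_ge0 ltW.
  by rewrite /a (powRM s (normr_ge0 _) ri0) powV.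
have wE : weight p r e t = eta / (r - t) `^ (p - 1).
  by rewrite /weight -/eta -powRN; congr (_ * _ `^ _); ring.
have dwE : eta * ((p - 1) / (r - t) `^ p) <= dweight p r e t.
  rewrite /dweight powRN lerDr; apply: mulr_ge0; last exact: powR_ge0.
  by apply: dcutoff_ge0; exact: ltW.
have young := powR_young p_gt1 a0 (normr_ge0 S).
rewrite -/k in young.
(* The balance of the coefficients of |f|^p / delta^p: the gain from differentiating delta^(1-p)
   minus the loss in Young's inequality. It rests on 1 - k = 1/p. *)
have kE : (p - 1) * k `^ (p - 1) - (p - 1) * k `^ p = k `^ p.
  have -> : k `^ p = k * k `^ (p - 1).
    by rewrite -[X in X * _]powRr1 ?ltW// -powRD ?gt_eqF ?implybT// addrC subrK.
  by rewrite /k; field; rewrite gt_eqF.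
have dnE : `|dnorm_powR p (f x) / (r - t) `^ (p - 1) * S| <= p * a `^ (p - 1) * `|S|.
  rewrite normrM ler_wpM2r// normrM normfV [`|(r - t) `^ _|]ger0_norm ?powR_ge0//.
  rewrite aE mulrA ler_wpM2r ?invr_ge0 ?powR_ge0// /dnorm_powR normrM (gtr0_norm p0).
  rewrite ler_wpM2l ?(ltW p0)// normrM [`|_ `^ _|]ger0_norm ?powR_ge0//.
  by rewrite ler_piMl ?powR_ge0// normr_sg; case: (f x != 0).
set A := `|f x| `^ p / (r - t) `^ p; set B := `|f x| `^ p / (r - t) `^ (p - 1).
have A_ge0 : 0 <= A by rewrite divr_ge0 ?powR_ge0.
have B_ge0 : 0 <= B by rewrite divr_ge0 ?powR_ge0.
have q0 : 0 <= k `^ (p - 1) by exact: powR_ge0.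
have h1 : eta * (k `^ (p - 1) * (M * B)) <= eta * (k `^ (p - 1) * (L * B)).
  by rewrite ler_wpM2l// ler_wpM2l// ler_wpM2r.
have h2 : k `^ (p - 1) * (eta * ((p - 1) * A)) <=
    k `^ (p - 1) * (`|f x| `^ p * dweight p r e t).
  rewrite ler_wpM2l//; apply: le_trans (ler_wpM2l (powR_ge0 _ _) dwE).
  have -> // : eta * ((p - 1) * A) =
      `|f x| `^ p * (eta * ((p - 1) / (r - t) `^ p)) by rewrite /A; ring.
have h3 : - (eta * k `^ (p - 1) * (p * a `^ (p - 1) * `|S|)) <=
    eta * k `^ (p - 1) * (dnorm_powR p (f x) / (r - t) `^ (p - 1) * S).
  have ek : 0 <= eta * k `^ (p - 1) by exact: mulr_ge0.
  rewrite -mulrN; apply: ler_wpM2l => //.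
  by move: dnE; rewrite ler_norml => /andP[].
have h4 : eta * (p * (k `^ (p - 1) * a `^ (p - 1)) * `|S|) <=
    eta * (`|S| `^ p + (p - 1) * (k `^ p * A)).
  by rewrite ler_wpM2l//; move: young; rewrite [a `^ p]aE.
have h5 : eta * `|S| `^ p <= `|S| `^ p by rewrite ler_piMl ?powR_ge0.
have -> : k `^ (p - 1) * (`|f x| `^ p * (weight p r e t * L + dweight p r e t) +
    weight p r e t * dnorm_powR p (f x) * S) =
    eta * (k `^ (p - 1) * (L * B)) +
    k `^ (p - 1) * (`|f x| `^ p * dweight p r e t) +
    eta * k `^ (p - 1) * (dnorm_powR p (f x) / (r - t) `^ (p - 1) * S).
  by rewrite wE /B; ring.
have kAE : k `^ p * A = (p - 1) * k `^ (p - 1) * A - (p - 1) * k `^ p * A.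
  by rewrite -mulrBl kE.
have h6 : eta * (k `^ p * A) = k `^ (p - 1) * (eta * ((p - 1) * A)) -
   eta * ((p - 1) * (k `^ p * A)) by rewrite [in LHS]kAE; ring.
rewrite [leLHS]mulrDr h6; lra.
Qed.

Lemma continuous_hardy_term (s : R) x : cdist c x < r ->
  {for x, continuous (fun y => `|f y| `^ p / (r - cdist c y) `^ s)}.
Proof.
move=> xr; apply: for_continuousM; first exact: (continuous_norm_powR_test p_gt1 f_test).
apply: (@for_continuousV _ _ (fun y => (r - cdist c y) `^ s)).
  by rewrite gt_eqF//; apply: powR_gt0; rewrite subr_gt0.
apply: (@continuous_comp _ _ _ (cdist c) (fun t => (r - t) `^ s)).
  exact: continuous_cdist.
exact: (is_derive_for_continuous (is_derive_rpowR s xr)).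
Qed.

Lemma continuous_curvature_factor x : U x ->
  {for x, continuous (fun y => (cdist c y)^-1 - (axdist y)^-1)}.
Proof.
move=> Ux; have x0 := axdist_gt0_punctured r_gt0 r_ltc Ux; have [d0 dr] := Ux.
apply: for_continuousB; apply: for_continuousV; rewrite ?gt_eqF//.
  exact: continuous_cdist.
exact: continuous_axdist.
Qed.

Lemma continuous_grad_term x : U x -> {for x, continuous
  (fun y => `|\sum_(i < 3) dcdist c i y * partial i f y| `^ p)}.
Proof.
move=> Ux; have x0 := axdist_gt0_punctured r_gt0 r_ltc Ux; have [d0 dr] := Ux.
apply: (@continuous_comp _ _ _
  (fun y => \sum_(i < 3) dcdist c i y * partial i f y) (fun t => `|t| `^ p)).
  apply: for_continuous_sum => i; apply: for_continuousM; first exact: continuous_dcdist.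
  exact: (test_continuous_partial f_test).
by apply: continuous_norm_powR; have := p_gt1; lra.
Qed.

Lemma cutoff_nondecreasing (t : R) : 0 < t ->
  {homo (fun n => cutoff (n.+1%:R^-1) t) : n m / (n <= m)%N >-> n <= m}.
Proof.
move=> t0 n m nm; rewrite /cutoff ler_pXn2r ?nnegrE ?le_max ?lexx ?orbT//.
have h : 1 - n.+1%:R^-1 / t <= 1 - m.+1%:R^-1 / t.
  rewrite lerD2l lerN2 ler_wpM2r ?invr_ge0 ?(ltW t0)//.
  by rewrite lef_pV2 ?posrE ?ltr0n// ler_nat ltnS.
by apply/orP; case: (leP (1 - n.+1%:R^-1 / t) 0) => _; [right|left].
Qed.

(** For fixed [t] the cutoff is continuous in its parameter at 0, where its value is 1. *)
Lemma cutoff_cvg (t : R) : 0 < t ->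
  (fun n => cutoff (n.+1%:R^-1) t) @ \oo --> (1 : R).
Proof.
move=> t0.
have h : {for (0 : R), continuous (fun s : R => Num.max (1 - s / t) 0 ^+ 2)}.
  apply: (@continuous_comp _ _ _ (fun s : R => 1 - s / t) (fun s => Num.max s 0 ^+ 2)).
    apply: for_continuousB; first exact: for_continuous_cst.
    by apply: for_continuousM; [exact: cvg_id|exact: for_continuous_cst].
  exact: (is_derive_for_continuous (is_derive_sqr_pos _)).
have h1 : Num.max (1 - s / t) 0 ^+ 2 @[s --> (0 : R)] --> (1 : R).
  have e1 : Num.max (1 - 0 / t) 0 ^+ 2 = 1 by rewrite mul0r subr0 max_l// expr1n.
  by rewrite -[X in _ --> X]e1; exact: h.
exact: (cvg_comp _ _ (@cvg_harmonic R) h1).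
Qed.

(** On the punctured torus the integrands coincide with the explicit formulas [F] and [b], whose
    continuity there supplies the measurability that monotone convergence requires. *)
Lemma hardy_punctured :
  (\int[lebesgue3 R]_(x in U)
     (k `^ p * (`|f x| `^ p / bdist Omega x `^ p) +
      k `^ (p - 1) * (((r - bdist Omega x)^-1 - (axdist x)^-1) *
                      (`|f x| `^ p / bdist Omega x `^ (p - 1))))%:E <=
   \int[lebesgue3 R]_(x in U)
     (`|dot (grad (bdist Omega) x) (grad f x)| `^ p)%:E)%E.
Proof.
pose F x := k `^ p * (`|f x| `^ p / (r - cdist c x) `^ p) +
  k `^ (p - 1) * (((cdist c x)^-1 - (axdist x)^-1) *
                  (`|f x| `^ p / (r - cdist c x) `^ (p - 1))).
pose b x := `|\sum_(i < 3) dcdist c i x * partial i f x| `^ p.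
have oU := @punctured_torus_open R r c.
have mU : measurable (U : set (mspace3 R)) by exact: open3_measurable.
have FE x : U x -> k `^ p * (`|f x| `^ p / bdist Omega x `^ p) +
      k `^ (p - 1) * (((r - bdist Omega x)^-1 - (axdist x)^-1) *
                      (`|f x| `^ p / bdist Omega x `^ (p - 1))) = F x.
  by move=> Ux; rewrite bdist_punctured// subKr.
have bE x : U x -> `|dot (grad (bdist Omega) x) (grad f x)| `^ p = b x.
  by move=> Ux; rewrite /Omega dot_grad_bdist// normrN.
have -> : (\int[lebesgue3 R]_(x in U)
     (k `^ p * (`|f x| `^ p / bdist Omega x `^ p) +
      k `^ (p - 1) * (((r - bdist Omega x)^-1 - (axdist x)^-1) *
                      (`|f x| `^ p / bdist Omega x `^ (p - 1))))%:E =
   \int[lebesgue3 R]_(x in U) (F x)%:E)%E.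
  by apply: eq_integral => x; rewrite inE => Ux; rewrite FE.
have -> : (\int[lebesgue3 R]_(x in U)
     (`|dot (grad (bdist Omega) x) (grad f x)| `^ p)%:E =
   \int[lebesgue3 R]_(x in U) (b x)%:E)%E.
  by apply: eq_integral => x; rewrite inE => Ux; rewrite bE.
have e0 n : 0 < n.+1%:R^-1 :> R by rewrite invr_gt0 ltr0n.
have flux n := flux_div_integral r_gt0 r_ltc p_gt1 (e0 n) f_test.
apply: (@integral_le_of_cutoff _ _ _ (lebesgue3 R) U
  (fun n x => cutoff n.+1%:R^-1 (cdist c x))
  (fun n => flux_div r c p n.+1%:R^-1 f) F b (k `^ (p - 1)) mU).
- move=> n; apply: open_continuous_measurable => // x [d0 dr].
  apply: (@continuous_comp _ _ _ (cdist c)); first exact: continuous_cdist.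
  exact: (is_derive_for_continuous (is_derive_cutoff _ (lt0r_neq0 d0))).
- apply: open_continuous_measurable => // x Ux; have [_ dr] := Ux.
  have h s := @continuous_hardy_term s x dr.
  have ct (s : R) : {for x, continuous (fun=> s)} by exact: for_continuous_cst.
  exact: (for_continuousD (for_continuousM (ct _) (h p)) (for_continuousM (ct _)
    (for_continuousM (continuous_curvature_factor Ux) (h (p - 1))))).
- by apply: open_continuous_measurable => // x; exact: continuous_grad_term.
- by move=> n x _; exact: cutoff_ge0.
- move=> x Ux; rewrite /F addr_ge0// mulr_ge0 ?powR_ge0//.
    by rewrite divr_ge0 ?powR_ge0.
  rewrite mulr_ge0// ?divr_ge0 ?powR_ge0//; apply: ltW.
  exact: (curvature_factor_gt0 r_gt0 r_ltc Ux).
- by move=> x _; exact: powR_ge0.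
- by move=> x [d0 _]; exact: cutoff_nondecreasing.
- by move=> x [d0 _]; exact: cutoff_cvg.
- by move=> n; exact: (flux n).1.
- by move=> n; exact: (flux n).2.
- move=> n x Ux; rewrite -bE//; have := hardy_pointwise (e0 n) Ux.
  by rewrite bdist_punctured.
Qed.

(** The core circle is null because it lies in this plane, a product with a one-point factor. *)
Lemma lebesgue3_horizontal :
  lebesgue3 R ([set: R * R] `*` [set (0 : R)]) = 0%E.
Proof.
rewrite /lebesgue3 product_measure1E; [|exact: measurableT|exact: measurable_set1].
have h := lebesgue_measure_set1 (0 : R).
by rewrite [X in (_ * X)%E]h mule0.
Qed.

Lemma hardy :
  ((k `^ p)%:E *
     \int[lebesgue3 R]_(x in Omega) (`|f x| `^ p / bdist Omega x `^ p)%:E +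
   (k `^ (p - 1))%:E *
     \int[lebesgue3 R]_(x in Omega)
       (((r - bdist Omega x)^-1 - (axdist x)^-1) *
        (`|f x| `^ p / bdist Omega x `^ (p - 1)))%:E <=
   \int[lebesgue3 R]_(x in Omega)
     (`|dot (grad (bdist Omega) x) (grad f x)| `^ p)%:E)%E.
Proof.
have rc : r < c by have := r_gt0; have := r_ltc; lra.
have oO := solid_torus_open rc.
have oU := @punctured_torus_open R r c.
have mO : measurable (Omega : set (mspace3 R)) by exact: open3_measurable.
have mU : measurable (U : set (mspace3 R)) by exact: open3_measurable.
have UO : U `<=` Omega by move=> x /(punctured_torus_sub r_gt0 r_ltc).
have OU x : (Omega `\` U) x -> cdist c x = 0.
  move=> [Ox nUx]; apply/eqP; rewrite eq_le cdist_ge0 andbT leNgt.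
  by apply/negP => d0; apply: nUx; split=> //; move: Ox; rewrite /Omega solid_torusE.
apply: (@integral_le_punctured _ _ _ (lebesgue3 R) U Omega) => //.
- apply: (subset_measure0 _ _ _ lebesgue3_horizontal).
  + exact: measurableD.
  + by apply: measurableX => //; exact: measurable_set1.
  + move=> x /OU d0; split=> //=; apply/eqP; rewrite -normr_le0 -d0.
    by rewrite -sqrtr_sqr ler_wsqrtr// lerDr sqr_ge0.
- exact: powR_ge0.
- exact: powR_ge0.
- apply: (@eq_measurable_fun _ _ _ _ Omega (fun x => `|f x| `^ p / (r - cdist c x) `^ p)).
    by move=> x; rewrite inE => Ox; rewrite (bdist_solid_torus r_gt0 rc).
  apply: open_continuous_measurable => // x Ox; apply: continuous_hardy_term.
  by move: Ox; rewrite /Omega solid_torusE.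
- by move=> x _; rewrite divr_ge0 ?powR_ge0.
- apply: (@eq_measurable_fun _ _ _ _ U (fun x => ((cdist c x)^-1 - (axdist x)^-1) *
      (`|f x| `^ p / (r - cdist c x) `^ (p - 1)))).
    by move=> x; rewrite inE => Ux; rewrite bdist_punctured// subKr.
  apply: open_continuous_measurable => // x Ux; have [_ dr] := Ux.
  by apply: for_continuousM; [exact: continuous_curvature_factor|exact: continuous_hardy_term].
- move=> x Ux; rewrite mulr_ge0 ?divr_ge0 ?powR_ge0//.
  rewrite bdist_punctured// subKr; apply: ltW.
  exact: (curvature_factor_gt0 r_gt0 r_ltc Ux).
(* On the core circle r - delta = 0 and its inverse is 0 by convention, so the factor becomes -
   1/rho, which has the sign that the comparison asks for. *)
- move=> x OUx; have Ox := OUx.1.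
  rewrite (bdist_solid_torus r_gt0 rc Ox) (OU x OUx) subr0 subrr invr0 sub0r.
  by rewrite mulNr oppr_le0 mulr_ge0 ?divr_ge0 ?powR_ge0// invr_ge0 axdist_ge0.
- exact: hardy_punctured.
Qed.

End hardy.

Theorem corollary4 (R : realType) (r Rmaj : R) (r2_gt0 : 0 < 2 * r)
    (r2_lt : 2 * r < Rmaj) :
  let Omega := solid_torus r Rmaj in
  let delta := bdist Omega in
  [/\ forall x : R * R * R, (Omega `\` ridge Omega) x ->
        has_laplacian delta x /\ laplacian delta x < 0,
      forall (p : R) (f : R * R * R -> R), 1 < p -> test_function Omega f ->
        (((((p - 1) / p) `^ p)%:E *
            \int[lebesgue3 R]_(x in Omega) (`|f x| `^ p / delta x `^ p)%:E
          + (((p - 1) / p) `^ (p - 1))%:E *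
            \int[lebesgue3 R]_(x in Omega)
              (((r - delta x)^-1 - (Num.sqrt (x.1.1 ^+ 2 + x.1.2 ^+ 2))^-1) *
               (`|f x| `^ p / delta x `^ (p - 1)))%:E)
        <= \int[lebesgue3 R]_(x in Omega)
             (`|dot (grad delta x) (grad f x)| `^ p)%:E)%E
    & forall x : R * R * R, (Omega `\` ridge Omega) x ->
        0 < (r - delta x)^-1 - (Num.sqrt (x.1.1 ^+ 2 + x.1.2 ^+ 2))^-1].
Proof.
have r_gt0 : 0 < r by lra.
split.
- move=> x /(setD_ridge_sub r_gt0 r2_lt) Ux; split.
    exact: (has_laplacian_bdist r_gt0 r2_lt Ux).
  exact: (laplacian_bdist_lt0 r_gt0 r2_lt Ux).
- move=> p f p1 fO; exact: (hardy r_gt0 r2_lt p1 fO).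
- move=> x /(setD_ridge_sub r_gt0 r2_lt) Ux.
  rewrite (bdist_punctured r_gt0 r2_lt Ux) subKr.
  exact: (curvature_factor_gt0 r_gt0 r2_lt Ux).
Qed.
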